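(* Let $q$ be a prime, let $a,b,\lambda$ be integers with $\gcd(a\lambda,q)=1$, let $M,N\geqslant 1$ be real numbers and let $\boldsymbol\alpha=(\alpha_m)_{m\leqslant M}$, $\boldsymbol\beta=(\beta_n)_{n\leqslant N}$ be complex weights. Define \[ W_{a,b,\lambda}(\boldsymbol\alpha,\boldsymbol\beta;M,N)=\sum_{m\leqslant M}\sum_{n\leqslant N}\alpha_m\beta_n\sum_{\substack{x\in\{0,\ldots,q-1\}\\ x^2\equiv amn+b\bmod q}}\exp(2\pi i\lambda x/q), \] with $m,n$ running over positive integers. Then \[ W_{a,b,\lambda}(\boldsymbol\alpha,\boldsymbol\beta;M,N)\ll\|\boldsymbol\alpha\|_2\,\|\boldsymbol\beta\|_\infty\left(M^{1/2}N^{1/2}+M^{1/2}Nq^{-1/4}+Nq^{1/4}(\log q)^{1/2}\right), \] uniformly over integers $a,b,\lambda$ with $\gcd(a\lambda,q)=1$.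
   Context: $\|\boldsymbol\alpha\|_2=(\sum_{m\leqslant M}|\alpha_m|^2)^{1/2}$, $\|\boldsymbol\beta\|_\infty=\max_{n\leqslant N}|\beta_n|$. $X\ll Y$ means $|X|\leqslant cY$ for an absolute constant $c$. *)

(* Defs.v *)
From HB Require Import structures.
From mathcomp Require Import all_boot all_order all_algebra.
From mathcomp Require Import complex.
From mathcomp Require Import all_classical all_reals all_analysis.
Set Implicit Arguments. Unset Strict Implicit. Unset Printing Implicit Defensive.
Import Order.TTheory GRing.Theory Num.Theory.
Local Open Scope ring_scope.

Definition cabs {R : realType} (z : R[i]) : R :=
  Num.sqrt (complex.Re z ^+ 2 + complex.Im z ^+ 2).

Definition e_ {R : realType} (t : R) : R[i] :=
  (cos (2 * pi * t) +i* sin (2 * pi * t))%C.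

Definition Wsum {R : realType} (q : nat) (a b lam : int) (alpha beta : nat -> R[i])
    (M N : R) : R[i] :=
  \sum_(1 <= m < (Num.truncn M).+1) \sum_(1 <= n < (Num.truncn N).+1)
    alpha m * beta n *
    \sum_(x < q | ((q%:Z) %| (x%:Z) ^+ 2 - (a * m%:Z * n%:Z + b))%Z)
       e_ ((lam * x%:Z)%:~R / (q%:R)).

Definition norm2 {R : realType} (alpha : nat -> R[i]) (M : R) : R :=
  Num.sqrt (\sum_(1 <= m < (Num.truncn M).+1) cabs (alpha m) ^+ 2).

Definition norminf {R : realType} (beta : nat -> R[i]) (N : R) : R :=
  \big[Num.max/0]_(1 <= n < (Num.truncn N).+1) cabs (beta n).

(* Main.v *)
Require Import Defs.
From HB Require Import structures.
From mathcomp Require Import all_boot all_order all_algebra all_field.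
From mathcomp Require Import complex.
From mathcomp Require Import all_classical all_reals all_analysis.
From mathcomp Require Import zify ring lra.

(** Write S(k) for the sum of e(lam x / q) over x^2 = k mod q.  By Cauchy's
    inequality it is enough to bound the sum over m <= M of |A(m)|^2, with
    A(m) the sum of beta_n S(amn + b), and a Fejer majorant replaces
    1 <= m <= M by differences i - j, so that no logarithm is lost.  As S is,
    up to a Gauss sum, the Fourier transform of t |-> chi(-t) e(lam^2 / 4t)
    for the quadratic character chi, the correlations of
    S(amn_1 + b) and S(amn_2 + b) become complete sums
      sum_x eta(x) e(B x + A / (x - s) + C / x),   eta in {1, chi}, B <> 0,
    whenever n_1 <> n_2 mod q, and Weil's bound gives 4 q^(1/2) for these.

    For Weil's bound, the L-function attached to the complete sum
    is a polynomial of degree at most 4, so the sums over F_(q^n) are power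
    sums of at most 4 numbers, and it suffices to bound them by O(q^(n/2))
    for large even n, with a constant that may depend on q.  As
    1 + chi(x) counts square roots, this only involves additive characters of
    rational functions f having a pole of order prime to q at infinity; there
    it follows from Stepanov's method in Bombieri's form, which bounds the
    number of x in F_(q^n) such that f(x) has a given trace. *)

Set Implicit Arguments. Unset Strict Implicit. Unset Printing Implicit Defensive.
Import Order.TTheory GRing.Theory Num.Theory.
Local Open Scope ring_scope.

(** * Weighted degrees in F[x][Y] *)

(** The differences i - j produce squares |D|^2 of a Dirichlet kernel, and orthogonality evaluates
    their sum over all frequencies, while a sum of |D| itself would cost a logarithm. So the second
    moment is bounded without log q; since (log q)^(1/2) is at least 1/2, the factor in the
    statement only doubles the constant. The degree 4 of the L-function comes from the poles 0 and
    s. A multiple of a polynomial with double zeros at both can be added to a monic polynomial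
    without changing its values or logarithmic derivatives there, and such a polynomial can reach
    the subleading coefficient only in degree above 4. Even n are singled out because then q^n = R^2
    with R = q^(n/2) a power of q, and Stepanov's method plays the R-th power against its own
    square. A bound for large n with an uncontrolled constant is enough, because one base of size
    above q^(1/2) would eventually break it. The prime q = 2 has no usable quadratic Gauss sums;
    there the trivial bound suffices. *)

Lemma linear_dependence (F : fieldType) (I J : finType) (a : I -> J -> F) :
  (#|J| < #|I|)%N ->
  exists k : I -> F, (exists i, k i != 0) /\ forall j, \sum_i k i * a i j = 0.
Proof.
move=> ltJI; pose A := \matrix_(i < #|I|, j < #|J|) a (enum_val i) (enum_val j).
have : kermx A != 0.
  rewrite -mxrank_eq0 mxrank_ker subn_eq0 -ltnNge.
  exact: leq_ltn_trans (rank_leq_col A) ltJI.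
case/rowV0Pn => x /sub_kermxP xA /rV0Pn[i0 xi0].
exists (fun i => x 0 (enum_rank i)); split.
  by exists (enum_val i0); rewrite enum_valK.
move=> j; move/rowP/(_ (enum_rank j)): xA; rewrite !mxE => {2}<-.
rewrite (reindex (@enum_val I I)) /=; last first.
  by exists enum_rank => i _; rewrite ?enum_valK ?enum_rankK.
by apply: eq_bigr => i _; rewrite !mxE enum_valK enum_rankK.
Qed.

Section WeightedDegree.

Variables (F : fieldType) (p w : nat).
Implicit Types P Q : {poly {poly F}}.

(* Weight p for the inner variable and w for the outer one. *)
Definition weight_le t P := forall i j, P`_j`_i != 0 -> (p * i + w * j <= t)%N.

Lemma weight_le0 t : weight_le t 0.
Proof. by move=> i j; rewrite !coef0 eqxx. Qed.

Lemma weight_leW t1 t2 P : (t1 <= t2)%N -> weight_le t1 P -> weight_le t2 P.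
Proof. by move=> le12 P1 i j /P1 /leq_trans->. Qed.

Lemma weight_leD t P Q : weight_le t P -> weight_le t Q -> weight_le t (P + Q).
Proof.
move=> wP wQ i j; rewrite !coefD => nz.
have [Pij|/negPn/eqP Pij] := boolP (P`_j`_i != 0); first exact: wP.
by apply: wQ; rewrite Pij add0r in nz.
Qed.

Lemma weight_le_sum t (I : finType) (D : pred I) (G : I -> {poly {poly F}}) :
  (forall i, D i -> weight_le t (G i)) -> weight_le t (\sum_(i | D i) G i).
Proof.
move=> wG; apply: (big_ind (weight_le t)) => //; [exact: weight_le0|exact: weight_leD].
Qed.

Lemma weight_leM t1 t2 P Q : weight_le t1 P -> weight_le t2 Q -> weight_le (t1 + t2) (P * Q).
Proof.
move=> wP wQ i j nz.
have [j1 [i1 [lej lei nzP nzQ]]] : exists j1 i1 : nat,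
  [/\ (j1 <= j)%N, (i1 <= i)%N, P`_j1`_i1 != 0 & Q`_(j - j1)`_(i - i1) != 0].
  rewrite coefM coef_sum in nz.
  have /existsP[j1 nz1] : [exists j1 : 'I_j.+1, (P`_j1 * Q`_(j - j1))`_i != 0].
    apply: contraNT nz => /existsPn H; apply/eqP.
    by rewrite big1 // => j1 _; apply/eqP; move: (H j1); rewrite negbK.
  rewrite coefM in nz1.
  have /existsP[i1 nz2] :
      [exists i1 : 'I_i.+1, P`_j1`_i1 * Q`_(j - j1)`_(i - i1) != 0].
    apply: contraNT nz1 => /existsPn H; apply/eqP.
    by rewrite big1 // => i1 _; apply/eqP; move: (H i1); rewrite negbK.
  exists j1, i1; move: nz2; rewrite mulf_eq0 negb_or => /andP[-> ->].
  by split=> //; rewrite -ltnS ltn_ord.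
have le1 := wP _ _ nzP; have le2 := wQ _ _ nzQ.
have -> : (p * i + w * j = p * i1 + w * j1 + (p * (i - i1) + w * (j - j1)))%N.
  by rewrite addnACA -!mulnDr !subnKC.
exact: leq_add.
Qed.

Lemma weight_leX t n P : weight_le t P -> weight_le (t * n) (P ^+ n).
Proof.
move=> wP; elim: n => [|n IHn].
  move=> i j; rewrite expr0 muln0 coef1; case: j => [|j] /=; last by rewrite coef0 eqxx.
  by rewrite coef1; case: i => [|i] /=; rewrite ?eqxx // !muln0.
by rewrite exprS mulnS; apply: weight_leM.
Qed.

Lemma weight_leC t (r : {poly F}) : (p * (size r).-1 <= t)%N -> weight_le t r%:P.
Proof.
move=> ler i j; rewrite coefC; case: j => [|j] /=; last by rewrite coef0 eqxx.
rewrite muln0 addn0 => nz; apply: leq_trans ler; rewrite leq_mul2l.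
have : (i < size r)%N by rewrite ltnNge; apply: contra nz => /(nth_default 0) ->.
by case: (size r) => //= n; rewrite ltnS => ->; rewrite orbT.
Qed.

Lemma weight_le_polyX : weight_le w 'X.
Proof.
move=> i j; rewrite coefX; case: (j =P 1%N) => [->|_] /=; last by rewrite coef0 eqxx.
by rewrite coef1; case: i => [|i] /=; rewrite ?eqxx // muln0 muln1.
Qed.

(* Reduction modulo Y^p - (al Y + be): a single substitution suffices for
   polynomials of Y-degree less than 2p - 1. *)
Definition reduce (al be : {poly F}) P :=
  take_poly p P + (al%:P * 'X + be%:P) * drop_poly p P.

Lemma reduceD al be P Q : reduce al be (P + Q) = reduce al be P + reduce al be Q.
Proof. by rewrite /reduce take_polyD drop_polyD mulrDr addrACA. Qed.

Lemma reduce_id al be P : (size P <= p)%N -> reduce al be P = P.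
Proof.
by move=> sP; rewrite /reduce take_poly_id // drop_poly_eq0 // mulr0 addr0.
Qed.

Lemma size_reduce al be P : (size P < 2 * p)%N -> (size (reduce al be P) <= p)%N.
Proof.
move=> sP; rewrite /reduce; apply: leq_trans (size_polyD _ _) _.
rewrite geq_max size_take_poly /=.
have [->|nz] := eqVneq (drop_poly p P) 0; first by rewrite mulr0 size_poly0.
apply: leq_trans (size_polyMleq _ _) _.
have s2 : (size (al%:P * 'X + be%:P)%R <= 2)%N.
  apply: leq_trans (size_polyD _ _) _; rewrite geq_max.
  rewrite (leq_trans (size_polyC_leq1 _)) // andbT.
  apply: leq_trans (size_polyMleq _ _) _; rewrite size_polyX.
  by have := size_polyC_leq1 al; lia.
move: nz; rewrite -size_poly_gt0 size_drop_poly; move: s2 sP.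
by move: (size _) (size P) => a b; lia.
Qed.

(** The hypotheses on [al] and [be] say that al Y + be weighs at most w p, the weight of the power
    Y^p that it replaces. *)
Lemma weight_le_reduce t (al be : {poly F}) P :
  (p * (size al).-1 + w <= w * p)%N -> (p * (size be).-1 <= w * p)%N ->
  weight_le t P -> weight_le t (reduce al be P).
Proof.
move=> leal lebe wP; apply: weight_leD.
  move=> i j; rewrite coef_take_poly; case: ifP => _; first exact: wP.
  by rewrite coef0 eqxx.
have [->|nz] := eqVneq (drop_poly p P) 0; first by rewrite mulr0; apply: weight_le0.
(* A nonzero upper part means that P contains a multiple of Y^p, so that t - w p is a true
   subtraction. *)
have lewt : (w * p <= t)%N.
  have : lead_coef (lead_coef (drop_poly p P)) != 0 by rewrite !lead_coef_eq0.
  rewrite !lead_coefE coef_drop_poly => /wP; apply: leq_trans.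
    by apply: leq_trans (leq_addl _ _); rewrite leq_mul2l leq_addl orbT.
rewrite -(subnKC lewt); apply: weight_leM.
  apply: weight_leD; last exact: weight_leC.
  by apply: weight_leW leal _; apply: weight_leM; [apply: weight_leC|apply: weight_le_polyX].
move=> i j; rewrite coef_drop_poly => /wP; rewrite mulnDr => le1.
by rewrite leq_subRL // addnC -addnA.
Qed.

End WeightedDegree.

Section Monomials.

Variables (p w : nat).
Hypotheses (p_gt0 : (0 < p)%N) (cop : coprime w p).

(** The bound t on the first exponent only makes the type finite; the second exponent stays below p
    because higher powers of Y are reduced. *)
Definition monomial t := {ab : 'I_t.+1 * 'I_p | (p * ab.1 + w * ab.2 <= t)%N}.

Definition weight t (m : monomial t) : nat := (p * (val m).1 + w * (val m).2)%N.

Lemma linear_weight_inj i j i' j' : (j < p)%N -> (j' < p)%N ->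
  (p * i + w * j = p * i' + w * j')%N -> i = i' /\ j = j'.
Proof.
move=> ltj ltj' eqw.
have eqj : j = j'.
  wlog lej : i j i' j' ltj ltj' eqw / (j <= j')%N.
    move=> H; have [|/ltnW] := leqP j j'; first exact: (H i j i' j').
    by move/(H i' j' i j ltj' ltj (esym eqw)).
  apply/eqP; rewrite eqn_leq lej /=.
  have : (p %| j' - j)%N.
    rewrite -(@Gauss_dvdr p w) 1?coprime_sym // mulnBr.
    have -> : (w * j' - w * j = p * i - p * i')%N by lia.
    by rewrite -mulnBr dvdn_mulr.
  have [/eqP|lt0 /dvdn_leq] := posnP (j' - j); first by rewrite subn_eq0.
  by move/(_ lt0); lia.
by split=> //; move: eqw; rewrite eqj => /addIn/eqP; rewrite eqn_pmul2l // => /eqP.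
Qed.

Lemma weight_inj t : injective (@weight t).
Proof.
move=> [[i j] lm] [[i' j'] lm'] /=; rewrite /weight /=.
move=> /linear_weight_inj[] // /val_inj ii /val_inj jj.
by apply/val_inj => /=; rewrite ii jj.
Qed.

Lemma card_monomial_le t : (#|{: monomial t}| <= t.+1)%N.
Proof.
have H (m : monomial t) : (weight m < t.+1)%N by rewrite ltnS; exact: (valP m).
have /leq_card : injective (fun m => Ordinal (H m)) by move=> m n [] /weight_inj.
by rewrite card_ord.
Qed.

(** If w j = s mod p with 0 <= j < p, then s + w p - w j is a nonnegative multiple of p. Thus every
    integer from w p on is a weight. *)
Lemma linear_weight_surj s : (0 < w)%N -> exists ij : nat * nat, (ij.2 < p)%N /\
  (p * ij.1 + w * ij.2 = s + w * p)%N.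
Proof.
move=> w_gt0; case: (egcdnP p w_gt0) => km kn; rewrite (eqP cop) => e1 _.
pose j := ((km * s) %% p)%N.
have ltj : (j < p)%N by rewrite ltn_mod.
have dv : (p %| s + w * p - w * j)%N.
  have lewj : (w * j <= w * p)%N by rewrite leq_mul2l ltnW ?orbT.
  rewrite -eqn_mod_dvd; last by rewrite (leq_trans lewj) // leq_addl.
  by rewrite addnC modnMDl modnMmr mulnA (mulnC w) e1 mulnDl mul1n mulnAC modnMDl.
exists ((s + w * p - w * j) %/ p, j)%N; split=> //=.
rewrite mulnC divnK // subnK //.
by apply: leq_trans (leq_addl _ _); rewrite leq_mul2l ltnW ?orbT.
Qed.

(** A substitute for the Riemann-Roch inequality on the curve, with w p in the place of the
    genus. *)
Lemma card_monomial_ge t : (0 < w)%N -> (t - w * p <= #|{: monomial t}|)%N.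
Proof.
move=> w_gt0.
have H (s : 'I_(t - w * p)) : exists m : monomial t, weight m == (s + w * p)%N.
  have [[i j] /= [ltj eqw]] := linear_weight_surj s w_gt0.
  have lt : (s + w * p <= t)%N by have := ltn_ord s; lia.
  have lti : (i < t.+1)%N by nia.
  have le' : (p * (Ordinal lti, Ordinal ltj).1 + w * (Ordinal lti, Ordinal ltj).2 <= t)%N.
    by rewrite /= eqw.
  by exists (exist _ (Ordinal lti, Ordinal ltj) le'); rewrite /weight /= eqw.
have /leq_card : injective (fun s => xchoose (H s)).
  move=> s s' e; apply/val_inj/(@addIn (w * p)) => /=.
  by rewrite -(eqP (xchooseP (H s))) e (eqP (xchooseP (H s'))).
by rewrite card_ord.
Qed.

End Monomials.

(** * Stepanov's method for y^p - y = u / v *)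

Lemma Fp_expX (p k : nat) (x : 'F_p) : prime p -> x ^+ (p ^ k) = x.
Proof.
move=> p_pr; elim: k => [|k IHk]; first by rewrite expn0 expr1.
by rewrite expnSr exprM IHk; have := expf_card x; rewrite card_Fp.
Qed.

Lemma size_expS (F : fieldType) (r : {poly F}) n :
  r != 0 -> size (r ^+ n) = ((size r).-1 * n).+1.
Proof.
move=> r0; rewrite -size_exp prednK // lt0n size_poly_eq0.
exact: expf_neq0.
Qed.

Section Frobenius.

Variables (p : nat) (K : fieldType).
Hypothesis (charK : p \in [pchar K]).

Lemma exprD_Frob k (x y : K) : (x + y) ^+ (p ^ k) = x ^+ (p ^ k) + y ^+ (p ^ k).
Proof.
elim: k => [|k IHk]; first by rewrite !expr1.
by rewrite expnSr !exprM IHk -!(pFrobenius_autE charK) rmorphD.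
Qed.

Lemma expr_sum_Frob k (I : Type) (r : seq I) (P : pred I) (G : I -> K) :
  (\sum_(i <- r | P i) G i) ^+ (p ^ k) = \sum_(i <- r | P i) G i ^+ (p ^ k).
Proof.
apply: (big_morph (fun x : K => x ^+ (p ^ k))); first exact: exprD_Frob.
by rewrite expr0n expn_eq0 (gtn_eqF (prime_gt0 (pcharf_prime charK))).
Qed.

Lemma exprN_Frob k (x : K) : (- x) ^+ (p ^ k) = - x ^+ (p ^ k).
Proof.
apply/eqP; rewrite -subr_eq0 opprK -exprD_Frob addNr expr0n expn_eq0.
by rewrite (gtn_eqF (prime_gt0 (pcharf_prime charK))).
Qed.

End Frobenius.

Lemma horner_Frob (p n : nat) (K : fieldType) (io : {rmorphism 'F_p -> K})
    (r : {poly 'F_p}) (x : K) : prime p ->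
  (map_poly io r).[x] ^+ (p ^ n) = (map_poly io r).[x ^+ (p ^ n)].
Proof.
move=> p_pr; rewrite !horner_coef.
rewrite (expr_sum_Frob (rmorph_pchar io (pchar_Fp p_pr))).
apply: eq_bigr => i _; rewrite exprMn coef_map -rmorphXn Fp_expX //.
by rewrite -!exprM mulnC.
Qed.

(** Equations against unknowns for the auxiliary polynomial: the right side minus the left side is R
    - (g^2 + 5 g + 5), and the hypothesis says exactly that this is positive. *)
Lemma dim_count R g : ((1 + g) * (g + 2) + 2 * g + 3 < R)%N ->
  ((R * R.-1 + (R + 2 * g + 2)).+1 < (R.-1 - g) * (R + 2 * g + 2 - g))%N.
Proof.
move=> ltR; have [r Rr] : exists r, R = (r + g).+1 by exists (R.-1 - g)%N; nia.
rewrite {}Rr in ltR *.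
have ltr : (g * g + 4 * g + 4 < r)%N.
  by move: ltR; rewrite mulnDr !mulnDl; lia.
rewrite /= addnK.
have -> : ((r + g).+1 + 2 * g + 2 - g = r + 2 * g + 3)%N by lia.
by rewrite -addnS mulSn !mulnDr !mulnDl; lia.
Qed.

Lemma total_weight_le R g l : l.+1 = R ->
  (l + R * (R + 2 * g + 2) <= R * R + (2 * g + 3) * R)%N.
Proof. by move=> <-; rewrite !mulnDr !mulnDl; lia. Qed.

Lemma reduction_weight p e d : (0 < p)%N ->
  (p * (e * p.-1) + (d + p * e) <= (d + p * e) * p)%N /\
  (p * (e * p.-1 + (d + e)) = (d + p * e) * p)%N.
Proof.
by case: p => // q _ /=; split; nia.
Qed.

(* Functions on the curve y^p - y = u / v are written in x and Y = v y, with
   pole orders p and w = d + p deg v at the point at infinity; Y is integral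
   over F_p[x].  With R = p^k, modulo the equation of the curve Y^R is
   al0 Y + T0, and Y^R - c v^R is al0 Y + tau. *)
Section Stepanov.

Variables (p : nat) (K : closedFieldType) (io : {rmorphism 'F_p -> K}).
Variables (u v : {poly 'F_p}) (d : nat) (c : 'F_p) (k : nat).
Hypotheses (p_pr : prime p) (v0 : v != 0) (su : size u = (d + size v)%N).
Hypotheses (d_gt0 : (0 < d)%N) (cop : coprime d p) (k_gt0 : (0 < k)%N).

Let e := (size v).-1.
Let w := (d + p * e)%N.
Let R := (p ^ k)%N.
Let T0 : {poly 'F_p} := \sum_(i < k) u ^+ (p ^ i) * v ^+ (R - p ^ i).
Let tau : {poly 'F_p} := T0 - c *: v ^+ R.
Let al0 : {poly 'F_p} := v ^+ R.-1.
Let al1 : {poly 'F_p} := v ^+ p.-1.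
Let be1 : {poly 'F_p} := v ^+ p.-1 * u.

Let p_gt1 : (1 < p)%N. Proof. exact: prime_gt1. Qed.
Let p_gt0 : (0 < p)%N. Proof. exact: prime_gt0. Qed.
Let R_gt1 : (1 < R)%N. Proof. by rewrite -(exp1n k) ltn_exp2r. Qed.
Let sv : size v = e.+1. Proof. by rewrite /e prednK // lt0n size_poly_eq0. Qed.
Let u0 : u != 0. Proof. by rewrite -size_poly_eq0 su addn_eq0 sv andbF. Qed.

Let cop_w : coprime w p.
Proof. by rewrite /coprime /w gcdnC addnC mulnC gcdnMDl gcdnC. Qed.
Let w_gt0 : (0 < w)%N. Proof. by rewrite addn_gt0 d_gt0. Qed.

(** The i-th term of [T0] has degree e R + d p^i, so the term i = k - 1 dominates, and it also
    dominates c v^R, of degree e R. *)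
Let size_T0 : size T0 = (e * R + d * p ^ k.-1).+1 /\
  size tau = (e * R + d * p ^ k.-1).+1.
Proof.
have sz i : (i <= k)%N -> size (u ^+ (p ^ i) * v ^+ (R - p ^ i)) = (e * R + d * p ^ i).+1.
  move=> lei; rewrite size_mul ?expf_neq0 // !size_expS // su sv.
  rewrite addSn addnS /= addnS /= mulnBr mulnDl.
  have : (e * p ^ i <= e * R)%N by rewrite leq_mul2l leq_exp2l ?lei ?orbT.
  lia.
have szlt i : (i < k.-1)%N ->
    (size (u ^+ (p ^ i) * v ^+ (R - p ^ i))%R < (e * R + d * p ^ k.-1).+1)%N.
  move=> lti; rewrite sz; last by lia.
  by rewrite ltnS ltn_add2l ltn_mul2l d_gt0 ltn_exp2l.
have [T1 [T0E sT1]] : exists T1, T0 = u ^+ (p ^ k.-1) * v ^+ (R - p ^ k.-1) + T1 /\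
    (size T1 < (e * R + d * p ^ k.-1).+1)%N.
  exists (\sum_(i < k.-1) u ^+ (p ^ i) * v ^+ (R - p ^ i)); split.
    by rewrite addrC /T0; case: k k_gt0 => // k' _; rewrite big_ord_recr.
  apply: leq_ltn_trans (size_sum _ _ _) _; rewrite ltnS.
  by apply/bigmax_leqP => i _; rewrite -ltnS szlt.
have szT : size (u ^+ (p ^ k.-1) * v ^+ (R - p ^ k.-1)) = (e * R + d * p ^ k.-1).+1.
  by rewrite sz // leq_pred.
split; first by rewrite T0E size_polyDl szT.
rewrite /tau T0E -addrA size_polyDl szT //.
apply: leq_ltn_trans (size_polyD _ _) _; rewrite gtn_max sT1 size_polyN /=.
apply: leq_ltn_trans (size_scale_leq _ _) _; rewrite size_expS // ltnS -addn1.
by rewrite -/e leq_add2l muln_gt0 d_gt0 expn_gt0 p_gt0.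
Qed.

Let wt_tau : (p * (e * R + d * p ^ k.-1) = R * w)%N.
Proof.
have -> : R = (p * p ^ k.-1)%N by rewrite -expnS prednK.
by rewrite /w; lia.
Qed.

Let lin (a b : {poly 'F_p}) : {poly {poly 'F_p}} := a%:P * 'X + b%:P.

(** The weight p e (R - 1) + w = R p e + d is below R w = R p e + R d as R > 1, so in [lin al0 tau]
    the constant term alone carries the top weight. *)
Let weight_le_al0 : weight_le p w (R * w).-1 (al0%:P * 'X).
Proof.
have -> : (R * w).-1 = ((R * w).-1 - w + w)%N.
  by rewrite subnK //; have := R_gt1; have := w_gt0; nia.
apply: weight_leM; last exact: weight_le_polyX.
apply: weight_leC; rewrite size_expS //= -/e.
by have := R_gt1; have := d_gt0; rewrite /w; case: (R) => // r _ _; nia.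
Qed.

Let weight_le_lin a b : b = tau \/ b = T0 -> a = al0 -> weight_le p w (R * w) (lin a b).
Proof.
move=> bE ->; apply: weight_leD; first by apply: weight_leW weight_le_al0; apply: leq_pred.
by apply: weight_leC; case: bE => ->; have [s1 s2] := size_T0; rewrite ?s1 ?s2 /= wt_tau.
Qed.

Let weight_le_red t P : weight_le p w t P -> weight_le p w t (reduce p al1 be1 P).
Proof.
have vp : size (v ^+ p.-1) = (e * p.-1).+1 by rewrite size_expS.
have [le_al eq_be] := reduction_weight e d p_gt0.
apply: weight_le_reduce; first by rewrite vp.
by rewrite size_mul ?expf_neq0 // vp su sv /= !addnS /= eq_be.
Qed.

Let size_linX a b n : (size (lin a b ^+ n) <= n.+1)%N.
Proof.
apply: leq_trans (size_poly_exp_leq _ _) _; rewrite ltnS.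
suff : ((size (lin a b)).-1 <= 1)%N by case: (_.-1) => [|[|]] //; rewrite ?mul0n ?mul1n.
have s2 : (size (lin a b) <= 2)%N.
  apply: leq_trans (size_polyD _ _) _; rewrite geq_max.
  rewrite (leq_trans (size_polyC_leq1 _)) // andbT.
  apply: leq_trans (size_polyMleq _ _) _; rewrite size_polyX.
  by case: (size a%:P) (size_polyC_leq1 a) => [|[]].
by case: (size _) s2.
Qed.

(* For a = x^m.1 Y^m.2 and b = x^n.1 Y^n.2, Eterm m n is a b(x^R, Y^R - c v^R)
   and Gterm m n is a^R b.  At the points of trace c the R-th power of Eterm
   equals Gterm, so a linear relation between the Gterms gives a combination
   of the Eterms vanishing at these points; it is nonzero because the pole
   orders of the Eterms are distinct. *)
Let Eterm (m : nat * nat) (n : nat * nat) : {poly {poly 'F_p}} :=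
  ('X^(m.1 + R * n.1))%:P * 'X^(m.2) * lin al0 tau ^+ n.2.

Let Gterm (m : nat * nat) (n : nat * nat) : {poly {poly 'F_p}} :=
  ('X^(R * m.1 + n.1))%:P * 'X^(n.2) * lin al0 T0 ^+ m.2.

Let size_term (a : {poly 'F_p}) (P : {poly {poly 'F_p}}) j j' :
  (j < p)%N -> (j' < p)%N -> (size P <= j'.+1)%N ->
  (size (a%:P * 'X^j * P)%R < 2 * p)%N.
Proof.
move=> lj lj' sP; rewrite -mulrA mul_polyC; apply: leq_ltn_trans (size_scale_leq _ _) _.
apply: leq_ltn_trans (size_polyMleq _ _) _; rewrite size_polyXn addSn /=.
by apply: leq_ltn_trans (leq_add (leqnn j) sP) _; lia.
Qed.

Let weight_le_term (a : {poly 'F_p}) (P : {poly {poly 'F_p}}) j t s :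
  size a = s.+1 -> weight_le p w t P ->
  weight_le p w (p * s + w * j + t) (a%:P * 'X^j * P).
Proof.
move=> sa wP; apply: weight_leM => //; apply: weight_leM; first by apply: weight_leC; rewrite sa.
exact/weight_leX/weight_le_polyX.
Qed.

Let Gterm_wle m n :
  weight_le p w (R * (p * m.1 + w * m.2) + (p * n.1 + w * n.2)) (Gterm m n).
Proof.
have H := weight_leX (n := m.2) (weight_le_lin (or_intror (erefl T0)) (erefl al0)).
apply: weight_leW (weight_le_term (j := n.2) (size_polyXn _ _) H).
by rewrite !mulnDr; lia.
Qed.

Let Eterm_wle m n :
  weight_le p w ((p * m.1 + w * m.2) + R * (p * n.1 + w * n.2)) (Eterm m n).
Proof.
have H := weight_leX (n := n.2) (weight_le_lin (or_introl (erefl tau)) (erefl al0)).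
apply: weight_leW (weight_le_term (j := m.2) (size_polyXn _ _) H).
by rewrite !mulnDr; lia.
Qed.

Let tau0 : tau != 0.
Proof. by rewrite -size_poly_eq0; have [_ ->] := size_T0. Qed.

(** The leading monomial comes from [tau ^+ n.2]. What remains contains a factor al0 Y, is therefore
    of smaller weight, and reduction cannot raise that weight. *)
Let Eterm_lead m n : (m.2 < p)%N ->
  exists i, (p * i + w * m.2 = (p * m.1 + w * m.2) + R * (p * n.1 + w * n.2))%N /\
    (reduce p al1 be1 (Eterm m n))`_m.2`_i != 0.
Proof.
move=> ltj; pose r := 'X^(m.1 + R * n.1) * tau ^+ n.2.
have r0 : r != 0 by rewrite mulf_neq0 ?expf_neq0 ?polyX_eq0.
have sr : (size r = (m.1 + R * n.1 + (e * R + d * p ^ k.-1) * n.2).+1)%N.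
  rewrite size_mul ?expf_neq0 ?polyX_eq0 // size_polyXn size_expS //.
  by have [_ ->] := size_T0; rewrite addnS.
have psr : (p * (m.1 + R * n.1 + (e * R + d * p ^ k.-1) * n.2) =
    p * m.1 + R * (p * n.1) + R * w * n.2)%N.
  by rewrite -wt_tau; lia.
pose Rest := ('X^(m.1 + R * n.1))%:P * 'X^(m.2) * (lin al0 tau ^+ n.2 - (tau%:P) ^+ n.2).
have EE : Eterm m n = r%:P * 'X^(m.2) + Rest.
  rewrite /Rest mulrBr addrC /Eterm -[LHS](subrK (r%:P * 'X^(m.2))); congr (_ - _ + _).
  rewrite /r polyCM [(tau ^+ _)%:P]polyC_exp; exact: mulrAC.
exists (size r).-1; split.
  by rewrite sr /= psr; lia.
rewrite EE reduceD reduce_id; last first.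
  by rewrite mul_polyC; apply: leq_trans (size_scale_leq _ _) _; rewrite size_polyXn.
rewrite 2!coefD mul_polyC coefZ coefXn eqxx mulr1 -lead_coefE.
suff -> : (reduce p al1 be1 Rest)`_m.2`_(size r).-1 = 0.
  by rewrite addr0 lead_coef_eq0.
have [n20|n20] := posnP n.2.
  by rewrite /Rest n20 !expr0 subrr mulr0 reduce_id ?size_poly0 // !coef0.
apply/eqP; apply: contraT => nz.
have wR : weight_le p w (p * (m.1 + R * n.1) + w * m.2 + ((R * w).-1 + R * w * n.2.-1)) Rest.
  apply: weight_le_term; first exact: size_polyXn.
  (* The difference of n.2-th powers has the factor al0 Y, and this factor saves one unit of
     weight. *)
  rewrite subrXX; apply: weight_leM; first by rewrite /lin addrK.
  apply: weight_le_sum => i _.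
  have wt0 : weight_le p w (R * w) tau%:P.
    by apply: weight_leC; have [_ ->] := size_T0; rewrite /= wt_tau.
  have lei : (i <= n.2.-1)%N by rewrite -ltnS prednK.
  rewrite -{1}(subnK lei) mulnDr; apply: weight_leM.
    by apply/weight_leX/weight_le_lin => //; left.
  exact: weight_leX.
have /weight_le_red /(_ _ _ nz) := wR.
rewrite sr /= psr mulnDr.
have Rw : (0 < R * w)%N by rewrite muln_gt0 w_gt0 ltnW.
have -> : (R * w * n.2 = R * w + R * w * n.2.-1)%N by rewrite -mulnS prednK.
by move: (R * w)%N Rw => Rw; lia.
Qed.

Let charK : p \in [pchar K].
Proof. exact: rmorph_pchar (pchar_Fp p_pr). Qed.

Section Evaluation.

Variables (x0 y0 : K).
Let ux := (map_poly io u).[x0].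
Let vx := (map_poly io v).[x0].
Hypotheses (vx0 : vx != 0) (y0E : y0 ^+ p - y0 = ux / vx).
Hypotheses (x0Q : x0 ^+ (p ^ (2 * k)) = x0).
Hypotheses (trx0 : \sum_(i < 2 * k) (ux / vx) ^+ (p ^ i) = io c).

Let evx : {rmorphism {poly 'F_p} -> K} := horner_eval x0 \o map_poly io.
Let Y0 := vx * y0.
Let ev : {rmorphism {poly {poly 'F_p}} -> K} := horner_eval Y0 \o map_poly evx.

Let evC a : ev a%:P = (map_poly io a).[x0].
Proof. by rewrite /ev /= map_polyC horner_evalE hornerC. Qed.

Let evX : ev 'X = Y0.
Proof. by rewrite /ev /= map_polyX horner_evalE hornerX. Qed.

Let y0X n : y0 ^+ (p ^ n) = y0 + \sum_(i < n) (ux / vx) ^+ (p ^ i).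
Proof.
elim: n => [|n IHn]; first by rewrite big_ord0 addr0.
rewrite expnS exprM -[y0 ^+ p](subrK y0) y0E addrC (exprD_Frob charK) IHn.
by rewrite -addrA big_ord_recr.
Qed.

Let evexp (a : {poly 'F_p}) n : (map_poly io (a ^+ n)).[x0] = (map_poly io a).[x0] ^+ n.
Proof. by rewrite rmorphXn horner_exp. Qed.

Let ev_T0 : ev (lin al0 T0) = Y0 ^+ R.
Proof.
rewrite /lin rmorphD rmorphM !evC evX evexp -/vx /Y0 mulrA -exprSr prednK 1?ltnW //.
rewrite exprMn y0X mulrDr; congr (_ + _).
rewrite rmorph_sum horner_sum mulr_sumr; apply: eq_bigr => i _.
rewrite rmorphM hornerM !evexp -/ux -/vx expr_div_n mulrCA; congr (_ * _).
rewrite expfB_cond // (negbTE vx0) add0n leq_exp2l // ltnW //.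
Qed.

Let ev_tau : ev (lin al0 tau) = Y0 ^+ R - io c * vx ^+ R.
Proof.
rewrite -ev_T0 /lin !rmorphD -addrA; congr (_ + _); rewrite !evC.
by congr (_ + _); rewrite -mul_polyC rmorphN rmorphM hornerN hornerM /= map_polyC hornerC evexp.
Qed.

(** Put Q = R^2. As c is the trace of u / v, Y0^Q = v (y0 + c), and c v^Q = c v is exactly what the
    subtraction in [tau] removes. *)
Let ev_tauX : ev (lin al0 tau) ^+ R = Y0.
Proof.
have QE : (p ^ (2 * k) = R * R)%N by rewrite mul2n -addnn expnD.
have vQ : vx ^+ (R * R) = vx by rewrite /vx -QE horner_Frob // x0Q.
rewrite ev_tau /R exprD_Frob // exprN_Frob // -/R.
rewrite (exprMn R (io c)) -(rmorphXn io) Fp_expX // -!exprM vQ -QE.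
by rewrite /Y0 exprMn {1}QE vQ y0X trx0 mulrDr (mulrC (io c)) addrK.
Qed.

(** The curve equation multiplied by v^p reads Y0^p = v^(p-1) Y0 + v^(p-1) u, so reduction does not
    change values. *)
Let ev_red P : ev (reduce p al1 be1 P) = ev P.
Proof.
have evl : ev (lin al1 be1) = Y0 ^+ p.
  rewrite /lin rmorphD rmorphM !evC evX.
  have -> : (map_poly io be1).[x0] = vx ^+ p.-1 * ux.
    by rewrite /be1 rmorphM hornerM evexp.
  rewrite evexp -/vx /Y0 exprMn.
  have -> : y0 ^+ p = ux / vx + y0 by rewrite -y0E subrK.
  by rewrite -{3}(prednK p_gt0) exprSr; field.
rewrite -{2}(poly_take_drop p P) /reduce -/(lin al1 be1) !rmorphD; congr (_ + _).
by rewrite [LHS]rmorphM [RHS]rmorphM evl rmorphXn evX mulrC.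
Qed.

Lemma ev_Eterm m n : ev (reduce p al1 be1 (Eterm m n)) ^+ R = ev (reduce p al1 be1 (Gterm m n)).
Proof.
rewrite !ev_red /Eterm /Gterm 2!rmorphM [in RHS]rmorphM [in RHS]rmorphM.
rewrite !(rmorphXn ev) !evC !map_polyXn !hornerXn evX ev_T0 !exprMn.
rewrite -(exprM (ev _)) (mulnC n.2) exprM ev_tauX -!exprM.
have x0X : x0 ^+ ((m.1 + R * n.1) * R) = x0 ^+ (R * m.1 + n.1).
  rewrite mulnDl !exprD mulnC; congr (_ * _).
  by rewrite mulnAC exprM -expnD addnn -mul2n x0Q.
by rewrite x0X (mulnC R m.2) /Y0 !exprMn; ring.
Qed.

End Evaluation.


Let size_redE m n : (m.2 < p)%N -> (n.2 < p)%N ->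
  (size (reduce p al1 be1 (Eterm m n)) <= p)%N.
Proof. by move=> lm ln; apply/size_reduce/(size_term _ lm ln)/size_linX. Qed.

Let size_redG m n : (m.2 < p)%N -> (n.2 < p)%N ->
  (size (reduce p al1 be1 (Gterm m n)) <= p)%N.
Proof. by move=> lm ln; apply/size_reduce/(size_term _ ln lm)/size_linX. Qed.

Let key t (mm : monomial p w t) : nat * nat := ((val mm).1 : nat, (val mm).2 : nat).

Let key_lt t (mm : monomial p w t) : ((key mm).2 < p)%N.
Proof. exact: ltn_ord. Qed.

Let key_wt t (mm : monomial p w t) : (p * (key mm).1 + w * (key mm).2 <= t)%N.
Proof. exact: (valP mm). Qed.

(* The combination E vanishes at the p points Y above each x, hence so do
   its coefficients, and the degree of one of them bounds the number of x. *)
Lemma artin_schreier_count (s : seq K) :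
  let g := (w * p)%N in
  ((1 + g) * (g + 2) + 2 * g + 3 < R)%N -> uniq s ->
  (forall x, x \in s -> [/\ (map_poly io v).[x] != 0, x ^+ (p ^ (2 * k)) = x &
    \sum_(i < 2 * k) ((map_poly io u).[x] / (map_poly io v).[x]) ^+ (p ^ i) = io c]) ->
  (p * size s <= p ^ (2 * k) + (2 * g + 3) * R)%N.
Proof.
(* Weights at most l < R act as digits in base R, which keeps the weights of the Eterms distinct;
   the excess of m over R makes the pairs of monomials outnumber the conditions. *)
move=> g ltR us sP; pose l := R.-1; pose m := (R + 2 * g + 2)%N.
have lR : (l.+1 = R)%N by rewrite prednK // ltnW.
pose I : finType := (monomial p w l * monomial p w m)%type.
pose J : finType := monomial p w (R * l + m).
pose GT (x : I) := reduce p al1 be1 (Gterm (key x.1) (key x.2)).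
pose ET (x : I) := reduce p al1 be1 (Eterm (key x.1) (key x.2)).
have cardJI : (#|J| < #|I|)%N.
  rewrite card_prod.
  have h1 := card_monomial_ge p_gt0 cop_w l w_gt0.
  have h2 := card_monomial_ge p_gt0 cop_w m w_gt0.
  have h3 := card_monomial_le p_gt0 cop_w (R * l + m).
  apply: leq_ltn_trans h3 _; apply: leq_trans (leq_mul h1 h2).
  exact: dim_count.
have [kap [[mn0 nz0] kap0]] :=
  linear_dependence (fun (x : I) (j : J) => (GT x)`_(key j).2`_(key j).1) cardJI.
have coefK (T : I -> {poly {poly 'F_p}}) i j :
    (\sum_x (kap x)%:P *: T x)`_j`_i = \sum_x kap x * (T x)`_j`_i.
  by rewrite coef_sum coef_sum; apply: eq_bigr => x _; rewrite coefZ coefCM.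
have wleZ (a : 'F_p) t P : weight_le p w t P -> weight_le p w t (a%:P *: P).
  move=> wP i j; rewrite coefZ coefCM mulf_eq0 negb_or => /andP[_]; exact: wP.
have sizeK (T : I -> {poly {poly 'F_p}}) : (forall x, size (T x) <= p)%N ->
    (size (\sum_x (kap x)%:P *: T x)%R <= p)%N.
  move=> sT; apply: leq_trans (size_sum _ _ _) _; apply/bigmax_leqP => x _.
  exact: leq_trans (size_scale_leq _ _) (sT x).
pose G := \sum_x (kap x)%:P *: GT x; pose E := \sum_x (kap x)%:P *: ET x.
(* G is reduced and of weight at most R l + m, so [J] lists all the monomials it can contain, and
   [kap] annihilates each of them. *)
have G0 : G = 0.
  apply/polyP => j; rewrite coef0; apply/polyP => i; rewrite coef0.
  apply/eqP; apply: contraT => nz.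
  have sG : (size G <= p)%N by apply: sizeK => x; apply: size_redG; apply: key_lt.
  have ltj : (j < p)%N.
    apply: leq_trans sG; rewrite ltnNge; apply: contra nz => sj.
    by rewrite (nth_default 0 sj) coef0.
  have wG : weight_le p w (R * l + m) G.
    apply: weight_le_sum => x _; apply: wleZ; apply: weight_le_red.
    apply: weight_leW (@Gterm_wle _ _); apply: leq_add; last exact: key_wt.
    by rewrite leq_mul2l key_wt orbT.
  have le1 := wG _ _ nz.
  have lti : (i < (R * l + m).+1)%N.
    by rewrite ltnS; apply: leq_trans (leq_trans (leq_addr _ _) le1); apply: leq_pmull.
  pose jj : J := exist _ (Ordinal lti, Ordinal ltj) le1.
  by move: nz; rewrite coefK; have /= -> := kap0 jj; rewrite eqxx.
have sE : (size E <= p)%N by apply: sizeK => x; apply: size_redE; apply: key_lt.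
pose WT (x : I) : nat := (weight x.1 + R * weight x.2)%N.
have wET x : weight_le p w (WT x) (ET x) by apply/weight_le_red/Eterm_wle.
have WT_inj : injective WT.
  move=> [a b] [a' b']; rewrite /WT /= => eqW.
  have la (y : monomial p w l) : (weight y < R)%N by rewrite -lR ltnS; exact: key_wt.
  have ab : weight a = weight a'.
    have : ((weight a + R * weight b) %% R = (weight a' + R * weight b') %% R)%N by rewrite eqW.
    by rewrite !(mulnC R) ![(_ + _ * R)%N]addnC !modnMDl !modn_small.
  move: eqW; rewrite ab => /addnI/eqP; rewrite eqn_pmul2l ?(ltnW R_gt1) // => /eqP.
  by move/(weight_inj p_gt0 cop_w) ->; move/(weight_inj p_gt0 cop_w): ab ->.
have [j [i nzE]] : exists j i, E`_j`_i != 0.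
  (* Among the terms with nonzero coefficient, the one of largest weight has a leading monomial that
     the others, of smaller weight, cannot reach. *)
  case: (arg_maxnP WT (nz0 : (fun x => kap x != 0) mn0)) => x nzx maxx.
  have [i [iE nzi]] := Eterm_lead (key x.2) (key_lt x.1).
  exists (key x.1).2, i; rewrite coefK (bigD1 x) //= big1 ?addr0.
    by rewrite mulf_neq0.
  move=> y neyx; have [->|ny] := eqVneq (kap y) 0; first by rewrite mul0r.
  apply/eqP; apply: contraT; rewrite mulf_eq0 negb_or => /andP[_ /wET].
  rewrite iE leqNgt; have ley : (WT y <= WT x)%N by exact: maxx.
  by rewrite [X in (_ < X)%N](_ : _ = WT x) // ltn_neqAle ley andbT (inj_eq WT_inj) neyx.
have wE : weight_le p w (l + R * m) E.
  apply: weight_le_sum => x _; apply: wleZ; apply: weight_leW (wET x); rewrite /WT.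
  apply: leq_add; first exact: key_wt x.1.
  by rewrite leq_mul2l [X in _ || X](_ : _ = true) ?orbT //; apply: key_wt x.2.
have roots : all (root (map_poly io E`_j)) s.
  apply/allP => x xs; have [vx0 xQ tr] := sP _ xs.
  set ux := (map_poly io u).[x] in tr; set vx := (map_poly io v).[x] in tr vx0.
  have [y yE] : exists y, y ^+ p - y = ux / vx.
    have /closed_rootP[y /rootP yr] : size ('X^p - ('X + (ux / vx)%:P))%R != 1.
      rewrite size_polyDl size_polyXn ?size_polyN ?size_XaddC //.
      by rewrite eqSS -lt0n.
    exists y; move: yr; rewrite !hornerE => /eqP; rewrite subr_eq0 => /eqP ->.
    by rewrite addrAC subrr add0r.
  pose evx : {rmorphism {poly 'F_p} -> K} := horner_eval x \o map_poly io.
  have evE a : (map_poly evx E).[vx * (y + io a)] = 0.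
    pose ev : {rmorphism {poly {poly 'F_p}} -> K} :=
      horner_eval (vx * (y + io a)) \o map_poly evx.
    have ya : (y + io a) ^+ p - (y + io a) = ux / vx.
      have := exprD_Frob charK 1 y (io a); rewrite expn1 => ->.
      have ap : a ^+ p = a by have := Fp_expX 1 a p_pr; rewrite expn1.
      by rewrite -rmorphXn ap -yE opprD addrACA subrr addr0.
    have evZ (b : 'F_p) P : ev (b%:P *: P) = io b * ev P.
      rewrite -mul_polyC rmorphM; congr (_ * _).
      by rewrite /ev /= map_polyC horner_evalE hornerC /= map_polyC horner_evalE hornerC.
    (* The coefficients [kap] lie in F_p, so the R-th power fixes them and turns E into G at this
       point. *)
    have : ev E ^+ R = 0.
      rewrite rmorph_sum (expr_sum_Frob charK) -[RHS](rmorph0 ev) -G0 rmorph_sum.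
      apply: eq_bigr => z _; rewrite !evZ exprMn -(rmorphXn io) Fp_expX //.
      by congr (_ * _); apply: ev_Eterm.
    by move/eqP; rewrite expf_eq0 => /andP[_ /eqP].
  have q0 : map_poly evx E = 0.
    apply: (@roots_geq_poly_eq0 _ _ [seq vx * (y + io a) | a <- enum 'F_p]).
    - by apply/allP => _ /mapP[a _ ->]; apply/rootP/evE.
    - rewrite map_inj_uniq ?enum_uniq // => a b /(mulfI vx0) /addrI; exact: fmorph_inj.
    - rewrite size_map -cardE card_Fp //; apply: leq_trans (size_poly _ _) sE.
  by apply/rootP; move/polyP/(_ j): q0; rewrite coef_map coef0.
have nzE0 : map_poly io E`_j != 0.
  by rewrite map_poly_eq0; apply: contraNneq nzE => ->; rewrite coef0.
have := max_poly_roots nzE0 roots us; rewrite size_map_poly.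
have : (E`_j)`_(size E`_j).-1 != 0.
  by rewrite -lead_coefE lead_coef_eq0; apply: contraNneq nzE0 => ->; rewrite rmorph0.
move/wE; rewrite /m => le1 lts.
have QE : (p ^ (2 * k) = R * R)%N by rewrite mul2n -addnn expnD.
have le2 : (p * size s <= p * (size (E`_j)%R).-1)%N.
  by rewrite leq_mul2l -ltnS prednK ?lts ?orbT //; apply: leq_ltn_trans lts.
rewrite QE; apply: leq_trans le2 _; apply: leq_trans (leq_addr _ _) (leq_trans le1 _).
exact: total_weight_le.
Qed.

End Stepanov.

(** * Character sums over the extensions of F_p *)

Section Closure.

Variables (p : nat) (K : closedFieldType) (io : {rmorphism 'F_p -> K}).
Hypothesis p_pr : prime p.

Let p_gt1 : (1 < p)%N. Proof. exact: prime_gt1. Qed.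
Let charK : p \in [pchar K].
Proof. exact: (rmorph_pchar io (pchar_Fp p_pr)). Qed.

Let q_gt1 n : (0 < n)%N -> (1 < p ^ n)%N.
Proof. by move=> n_gt0; rewrite -[X in (X < _)%N](exp1n n) ltn_exp2r. Qed.

(** All extensions sit in one closed field, so that an element can be compared with square roots
    outside its own extension. *)
Definition Fpn n : seq K := sval (closed_field_poly_normal ('X^(p ^ n) - 'X : {poly K})).

Lemma Fpn_prod n : (0 < n)%N -> 'X^(p ^ n) - 'X = \prod_(z <- Fpn n) ('X - z%:P).
Proof.
move=> n_gt0; have q1 := q_gt1 n_gt0.
rewrite /Fpn; case: closed_field_poly_normal => r /= {1}->.
suff -> : lead_coef ('X^(p ^ n) - 'X : {poly K}) = 1 by rewrite scale1r.
by rewrite lead_coefDl ?lead_coefXn // size_polyN size_polyX size_polyXn ltnS.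
Qed.

Lemma mem_Fpn n x : (0 < n)%N -> (x \in Fpn n) = (x ^+ (p ^ n) == x).
Proof.
by move=> n0; rewrite -root_prod_XsubC -Fpn_prod // /root !hornerE subr_eq0.
Qed.

Lemma size_Fpn n : (0 < n)%N -> size (Fpn n) = (p ^ n)%N.
Proof.
move=> n0; apply/eqP; rewrite -eqSS -(size_prod_XsubC _ id) -Fpn_prod //.
rewrite size_polyDl size_polyXn // size_polyN size_polyX ltnS.
exact: q_gt1.
Qed.

Lemma uniq_Fpn n : (0 < n)%N -> uniq (Fpn n).
Proof.
move=> n0; rewrite -separable_prod_XsubC -Fpn_prod // separable_poly.unlock.
rewrite derivB derivXn derivX -scaler_nat.
have -> : (p ^ n)%:R = 0 :> K.
  by rewrite natrX (pcharf0 charK) expr0n; case: n n0.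
rewrite scale0r sub0r (_ : -1 = (-1 : K) *: 1 :> {poly K}); last by rewrite scaleN1r.
by rewrite coprimepZr ?oppr_eq0 ?oner_eq0 // coprimep1.
Qed.

(* The junk value is 0 when [y] is not in the prime field. *)
Definition inFp (y : K) : 'F_p := odflt 0 [pick c | io c == y].

Lemma inFpK y : y ^+ p = y -> io (inFp y) = y.
Proof.
move=> yp; rewrite /inFp; case: pickP => [c /eqP //|no].
have := @max_poly_roots K ('X^p - 'X) (y :: [seq io c | c <- enum 'F_p]).
have sX : size ('X^p - 'X : {poly K}) = p.+1.
  by rewrite size_polyDl size_polyXn // size_polyN size_polyX ltnS.
rewrite sX /= size_map -cardE card_Fp // ltnn => H.
exfalso; apply: notF; apply: H.
- by rewrite -size_poly_eq0 sX.
- rewrite /root !hornerE yp subrr eqxx /=; apply/allP => _ /mapP[c _ ->].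
  by rewrite /root !hornerE -rmorphXn -[X in _ ^+ X]expn1 Fp_expX // subrr.
rewrite map_inj_uniq ?enum_uniq ?andbT; last exact: fmorph_inj.
by apply/mapP => -[c _ yc]; move: (no c); rewrite yc eqxx.
Qed.

Lemma inFp_io : cancel io inFp.
Proof.
move=> c; apply: (fmorph_inj io); apply: inFpK.
by rewrite -rmorphXn; have := Fp_expX 1 c p_pr; rewrite expn1 => ->.
Qed.

Definition trFp n (x : K) := \sum_(i < n) x ^+ (p ^ i).
Definition nmFp n (x : K) := \prod_(i < n) x ^+ (p ^ i).

Lemma trFp_fixed n x : x ^+ (p ^ n) = x -> trFp n x ^+ p = trFp n x.
Proof.
move=> xn; rewrite /trFp -[X in _ ^+ X]expn1 (expr_sum_Frob charK).
have -> : \sum_(i < n) (x ^+ (p ^ i)) ^+ (p ^ 1) = \sum_(i < n) x ^+ (p ^ i.+1).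
  by apply: eq_bigr => i _; rewrite expn1 -exprM -expnSr.
case: n xn => [|n] xn; first by rewrite !big_ord0.
by rewrite big_ord_recr big_ord_recl /= xn expn0 expr1 addrC.
Qed.

Lemma nmFp_fixed n x : x ^+ (p ^ n) = x -> nmFp n x ^+ p = nmFp n x.
Proof.
move=> xn; rewrite /nmFp -prodrXl.
have -> : \prod_(i < n) (x ^+ (p ^ i)) ^+ p = \prod_(i < n) x ^+ (p ^ i.+1).
  by apply: eq_bigr => i _; rewrite -exprM -expnSr.
case: n xn => [|n] xn; first by rewrite !big_ord0.
by rewrite big_ord_recr big_ord_recl /= xn expn0 expr1 mulrC.
Qed.

Section CharSum.

Variables (C : numClosedFieldType) (psi : 'F_p -> C).
Hypotheses (psi_norm : forall a, `|psi a| = 1) (psi_sum : \sum_a psi a = 0).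

Variables (u v : {poly 'F_p}) (d : nat).
Hypotheses (v0 : v != 0) (su : size u = (d + size v)%N).
Hypotheses (d_gt0 : (0 < d)%N) (cop : coprime d p).

Let ratv (r : {poly 'F_p}) (x : K) := (map_poly io r).[x].

Definition expsum n : C :=
  \sum_(x <- Fpn n | (map_poly io v).[x] != 0)
    psi (inFp (trFp n ((map_poly io u).[x] / (map_poly io v).[x]))).

(* The upper bounds for all trace classes add up to almost p^(2k), which turns
   them into lower bounds. *)
Lemma expsum_even_le :
  exists B k0 : nat, forall k, (k0 <= k)%N -> `|expsum (2 * k)| <= (B * p ^ k)%:R.
Proof.
pose w := (d + p * (size v).-1)%N; pose g := (w * p)%N.
(* The part 2 g + 3 is the excess allowed to a trace class, and [size v] pays for the zeros of v,
   which lie in no class. The threshold works because k < p^k. *)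
exists (2 * g + 3 + size v)%N, ((1 + g) * (g + 2) + 2 * g + 3).+1 => k lek.
have k_gt0 : (0 < k)%N by apply: leq_trans lek.
have k2_gt0 : (0 < 2 * k)%N by rewrite muln_gt0.
have Rk : ((1 + g) * (g + 2) + 2 * g + 3 < p ^ k)%N.
  by apply: leq_trans lek (ltnW _); apply: ltn_expl.
pose tv x := inFp (trFp (2 * k) (ratv u x / ratv v x)).
pose A c := [seq x <- Fpn (2 * k) | (ratv v x != 0) && (tv x == c)].
pose M := (p ^ (2 * k) + (2 * g + 3) * p ^ k)%N.
have AM c : (p * size (A c) <= M)%N.
  apply: (artin_schreier_count (io := io) (c := c) p_pr v0 su d_gt0 cop k_gt0 Rk).
    by rewrite filter_uniq ?uniq_Fpn.
  move=> x; rewrite mem_filter mem_Fpn // => /andP[/andP[vx /eqP tc] /eqP xQ].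
  split=> //; rewrite -tc inFpK // trFp_fixed // expr_div_n.
  by rewrite !horner_Frob // xQ.
have sumA : (\sum_c size (A c) = count (fun x => ratv v x != 0%R) (Fpn (2 * k)))%N.
  rewrite -sum1_count (partition_big tv predT) //=; apply: eq_bigr => c _.
  by rewrite size_filter -sum1_count.
have geA : (p ^ (2 * k) <= \sum_c size (A c) + size v)%N.
  rewrite sumA -(size_Fpn k2_gt0) -(count_predC (fun x => ratv v x != 0)) leq_add2l.
  rewrite -size_filter; apply: ltnW.
  rewrite -(size_map_poly io v); apply: max_poly_roots.
  - by rewrite map_poly_eq0.
  - by apply/allP => x; rewrite mem_filter => /andP[/negPn].
  - by rewrite filter_uniq ?uniq_Fpn.
have SE : expsum (2 * k) = \sum_c (size (A c))%:R * psi c.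
  rewrite /expsum (partition_big tv predT) //=; apply: eq_bigr => c _.
  rewrite size_filter -sum1_count natr_sum mulr_suml; apply: eq_bigr => x /andP[_ /eqP <-].
  by rewrite mul1r.
(* As psi sums to 0, the constant M can be subtracted from every class; the deficits are
   nonnegative, so their total bounds the sum. *)
have pSE : p%:R * expsum (2 * k) = - \sum_c (M - p * size (A c))%:R * psi c.
  have -> : p%:R * expsum (2 * k) = p%:R * expsum (2 * k) - M%:R * \sum_c psi c.
    by rewrite psi_sum mulr0 subr0.
  rewrite SE !mulr_sumr -sumrB -sumrN.
  by apply: eq_bigr => c _; rewrite natrB // natrM; ring.
have p0 : 0 < p%:R :> C by rewrite ltr0n prime_gt0.
rewrite -(ler_pM2l p0) -[p%:R in leLHS]gtr0_norm // -normrM pSE normrN.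
apply: le_trans (ler_norm_sum _ _ _) _.
under eq_bigr => c _ do rewrite normrM psi_norm mulr1 normr_nat.
rewrite -natr_sum -natrM ler_nat.
have : (\sum_c (M - p * size (A c)) + p * \sum_c size (A c) = p * M)%N.
  rewrite big_distrr -big_split /= -[in RHS](card_Fp p_pr) -sum_nat_const.
  by apply: eq_bigr => c _; rewrite subnK.
move: (\sum_c (M - p * size (A c)))%N (\sum_c size (A c))%N geA => X Y geA XY.
rewrite -(leq_add2r (p * Y)) XY -mulnDr leq_mul2l; apply/orP; right.
rewrite /M; have : (0 < p ^ k)%N by rewrite expn_gt0 prime_gt0.
rewrite mulnDl; nia.
Qed.

End CharSum.

End Closure.

(** * The L-function *)

Section MonicPolynomials.

Variable F : fieldType.
Implicit Types P Q : {poly F}.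

Lemma prod_XsubC_expn_dvdp (L : seq F) a P : uniq L ->
  (forall z, z \in L -> ('X - z%:P) ^+ a %| P) ->
  (\prod_(z <- L) ('X - z%:P)) ^+ a %| P.
Proof.
elim: L => [|z L IHL] /=; first by rewrite big_nil expr1n dvd1p.
case/andP => zL uL dv; rewrite big_cons exprMn Gauss_dvdp.
  rewrite dv ?mem_head //=; apply: IHL => // y yL; apply: dv.
  by rewrite inE yL orbT.
apply/coprimep_expl/coprimep_expr; rewrite coprimep_sym coprimep_XsubC.
by rewrite root_prod_XsubC.
Qed.

(* The coefficient following the leading one; the subtraction makes it
   vanish at [P = 1]. *)
Definition subcoef P := (P - 'X^((size P).-1))`_(size P).-2.

Definition dlog z P := P^`().[z] / P.[z].

Lemma size_monic_tail P : P \is monic ->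
  (size (P - 'X^((size P).-1))%R <= (size P).-1)%N.
Proof.
move=> mP; apply/leq_sizeP => j lej; rewrite coefB coefXn.
case: (ltngtP j (size P).-1) lej => // [ltj _|-> _]; last first.
  by rewrite -lead_coefE (monicP mP) subrr.
by rewrite subr0 nth_default //; apply: leq_trans ltj; apply: leqSpred.
Qed.

(** The two tails have a product of too low a degree to matter, so only each tail times the other
    leading power contributes. *)
Lemma subcoefM P Q : P \is monic -> Q \is monic ->
  subcoef (P * Q) = subcoef P + subcoef Q.
Proof.
move=> mP mQ; have [sp sq] := (size_monic_tail mP, size_monic_tail mQ).
have sPQ : (size (P * Q)).-1 = ((size P).-1 + (size Q).-1)%N.
  have [P0 Q0] : (0 < size P /\ 0 < size Q)%N by rewrite !size_poly_gt0 !monic_neq0.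
  by rewrite size_mul ?monic_neq0 //; move: (size P) (size Q) P0 Q0 => a b; lia.
rewrite /subcoef sPQ.
move: (size P).-1 (size Q).-1 sp sq sPQ => n m.
set p1 := P - _; set q1 := Q - _ => sp sq _.
have -> : P * Q - 'X^(n + m) = 'X^n * q1 + 'X^m * p1 + p1 * q1.
  by rewrite /p1 /q1 exprD; ring.
have sh a b (r : {poly F}) : (size r <= b)%N -> ('X^a * r)`_(a + b).-1 = r`_b.-1.
  case: b => [|b] sr; last by rewrite addnS /= coefXnM ltnNge leq_addr /= addKn.
  by move: sr; rewrite leqn0 size_poly_eq0 => /eqP->; rewrite mulr0 !coef0.
rewrite 2!coefD sh // [(n + m)%N]addnC sh // [X in _ + X]nth_default ?addr0 1?addrC //.
have [->|p10] := eqVneq p1 0; first by rewrite mul0r size_poly0.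
have [->|q10] := eqVneq q1 0; first by rewrite mulr0 size_poly0.
rewrite size_mul //; move: sp sq; rewrite -!size_poly_gt0 in p10 q10.
by rewrite addnC; move: (size p1) (size q1) p10 q10 => a b; lia.
Qed.

Lemma subcoef1 : subcoef 1 = 0.
Proof. by rewrite /subcoef size_poly1 expr0 subrr coef0. Qed.

Lemma subcoef_XsubC z : subcoef ('X - z%:P) = - z.
Proof.
by rewrite /subcoef size_XsubC /= expr1 addrAC subrr add0r coefN coefC.
Qed.

Lemma subcoef_prod (s : seq F) :
  subcoef (\prod_(z <- s) ('X - z%:P)) = - \sum_(z <- s) z.
Proof.
elim: s => [|z s IHs]; first by rewrite !big_nil subcoef1 oppr0.
by rewrite !big_cons subcoefM ?monicXsubC ?monic_prod_XsubC // subcoef_XsubC IHs opprD.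
Qed.

Lemma dlogM z P Q : P.[z] != 0 -> Q.[z] != 0 -> dlog z (P * Q) = dlog z P + dlog z Q.
Proof.
by move=> Pz Qz; rewrite /dlog derivM !hornerE; field; rewrite Pz Qz.
Qed.

Lemma dlog1 z : dlog z 1 = 0.
Proof. by rewrite /dlog derivC horner0 mul0r. Qed.

Lemma dlog_prod z (s : seq F) : z \notin s ->
  dlog z (\prod_(y <- s) ('X - y%:P)) = \sum_(y <- s) (z - y)^-1.
Proof.
elim: s => [|y s IHs]; first by rewrite !big_nil dlog1.
rewrite inE negb_or => /andP[zy zs]; rewrite !big_cons dlogM ?IHs //.
- by rewrite /dlog derivXsubC hornerC hornerXsubC mul1r.
- by rewrite !hornerE subr_eq0.
by move: zs; rewrite -root_prod_XsubC.
Qed.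

End MonicPolynomials.

Lemma subcoef_map (F K : fieldType) (io : {rmorphism F -> K}) P :
  subcoef (map_poly io P) = io (subcoef P).
Proof.
by rewrite /subcoef size_map_poly -(map_polyXn io) -rmorphB coef_map.
Qed.

Lemma dlog_map (F K : fieldType) (io : {rmorphism F -> K}) z P :
  dlog (io z) (map_poly io P) = io (dlog z P).
Proof. by rewrite /dlog deriv_map !horner_map fmorph_div. Qed.

(** * Characteristic polynomials of elements of the extensions of F_p *)

Section Conjugates.

Variables (p : nat) (K : closedFieldType) (io : {rmorphism 'F_p -> K}).
Hypothesis p_pr : prime p.

Let p_gt1 : (1 < p)%N. Proof. exact: prime_gt1. Qed.
Let charK : p \in [pchar K].
Proof. exact: (rmorph_pchar io (pchar_Fp p_pr)). Qed.
Let phi : {rmorphism K -> K} := pFrobenius_aut charK.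
Let phiE x : phi x = x ^+ p. Proof. exact: pFrobenius_autE. Qed.


Definition conjugates n (x : K) := [seq x ^+ (p ^ i) | i <- iota 0 n].
(** The characteristic polynomial of x over F_p in degree n, brought down to F_p by [inFp];
    meaningful for x in F_(p^n). *)
Definition conjpoly n x : {poly 'F_p} :=
  map_poly (inFp io) (\prod_(z <- conjugates n x) ('X - z%:P)).

Lemma io_Frob n (c : 'F_p) : io c ^+ (p ^ n) = io c.
Proof. by rewrite -rmorphXn Fp_expX. Qed.

Lemma map_phi_io P : map_poly phi (map_poly io P) = map_poly io P.
Proof.
rewrite -map_poly_comp; apply: eq_map_poly => c /=.
by rewrite phiE; have := io_Frob 1 c; rewrite expn1.
Qed.

(** Frobenius permutes the factors cyclically, hence fixes the coefficients, which therefore lie in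
    F_p. *)
Lemma conjpolyE n x : x ^+ (p ^ n) = x ->
  map_poly io (conjpoly n x) = \prod_(z <- conjugates n x) ('X - z%:P).
Proof.
move=> xn; rewrite /conjpoly; set P := \prod_(z <- _) _.
have PP : map_poly phi P = P.
  rewrite /P rmorph_prod big_map [in RHS]big_map.
  under eq_bigr => i _ do rewrite rmorphB /= map_polyX map_polyC /= phiE -exprM -expnSr.
  case: n xn {P} => [|n] xn; first by rewrite !big_nil.
  rewrite -[iota 0 n.+1]/(index_iota 0 n.+1) big_nat_recr // [in RHS]big_nat_recl //=.
  by rewrite xn expn0 expr1 mulrC.
apply/polyP => i; rewrite coef_map coef_map_id0; last first.
  by rewrite -(rmorph0 io) inFp_io.
by apply: inFpK => //; rewrite -phiE -coef_map PP.
Qed.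

Lemma conjpoly_monic n x : x ^+ (p ^ n) = x -> conjpoly n x \is monic.
Proof.
move=> xn; rewrite -(map_monic io) conjpolyE //; exact: monic_prod_XsubC.
Qed.

Lemma size_conjpoly n x : x ^+ (p ^ n) = x -> size (conjpoly n x) = n.+1.
Proof.
move=> xn; rewrite -(size_map_poly io) conjpolyE // size_prod_XsubC.
by rewrite size_map size_iota.
Qed.

Lemma expr_Frob_inj n (x y : K) : x ^+ (p ^ n) = y ^+ (p ^ n) -> x = y.
Proof.
move=> e; apply/eqP; rewrite -subr_eq0.
have : (x - y) ^+ (p ^ n) == 0.
  by rewrite (exprD_Frob charK) (exprN_Frob charK) e subrr.
by rewrite expf_eq0 => /andP[].
Qed.

Lemma dvdp_conj (P : {poly 'F_p}) (x : K) a i :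
  ('X - x%:P) ^+ a %| map_poly io P -> ('X - (x ^+ (p ^ i))%:P) ^+ a %| map_poly io P.
Proof.
move=> dv; elim: i => [|i IHi]; first by rewrite expn0 expr1.
move: IHi; rewrite -(dvdp_map phi) map_phi_io rmorphXn rmorphB /= map_polyX map_polyC.
by rewrite /= phiE -exprM -expnSr.
Qed.

Section Root.

Variables (P : {poly 'F_p}) (x : K).
Hypotheses (P0 : P != 0) (rx : root (map_poly io P) x).

Let n := (size P).-1.
Let P0' : map_poly io P != 0. Proof. by rewrite map_poly_eq0. Qed.

(** The n + 1 first conjugates of x are roots of P, of degree n, so two of them coincide;
    injectivity of Frobenius cancels the smaller power. *)
Lemma root_periodic : exists2 k, (0 < k)%N & x ^+ (p ^ k) = x.
Proof.
have sub : all (root (map_poly io P)) (conjugates n.+1 x).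
  apply/allP => _ /mapP[i _ ->].
  have := @dvdp_conj P x 1 i; rewrite !expr1 -!root_factor_theorem; exact.
have /uniqPn : ~~ uniq (conjugates n.+1 x).
  apply: contraL sub => u; apply/negP => sub.
  have := max_poly_roots P0' sub u; rewrite size_map_poly size_map size_iota.
  by rewrite /n prednK ?ltnn // size_poly_gt0.
move=> /(_ 0) [i [j [ltij ltj]]].
rewrite size_map size_iota in ltj.
rewrite !(nth_map 0%N) ?size_iota ?(ltn_trans ltij) // !nth_iota ?(ltn_trans ltij) //.
rewrite !add0n => e; exists (j - i)%N; first by rewrite subn_gt0.
apply: (@expr_Frob_inj i); rewrite -exprM -expnD subnK //; exact: ltnW.
Qed.

(* If x has period dl under Frobenius then conjpoly (j * dl) x is the j-th power
   of the minimal polynomial of x. *)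
Lemma count_conjpoly_dvd :
  (\sum_(1 <= k < n.+1) ((x ^+ (p ^ k) == x)%R && (conjpoly k x %| P)%R) =
   mup x (map_poly io P))%N.
Proof.
have ex : exists k, (0 < k)%N && (x ^+ (p ^ k) == x).
  by have [k k0 /eqP xk] := root_periodic; exists k; rewrite k0.
case: (ex_minnP ex) => dl /andP[dl0 /eqP xdl] mindl {ex}.
set a := mup x _.
have xmul j : x ^+ (p ^ (j * dl)) = x.
  by elim: j => [|j IHj]; rewrite ?expr1 // mulSn expnD exprM xdl.
have fixedE k : (x ^+ (p ^ k) == x) = (dl %| k)%N.
  apply/idP/idP => [/eqP xk|/dvdnP[j ->]]; last by rewrite xmul.
  rewrite /dvdn; case: posnP => // rgt0.
  have : (dl <= k %% dl)%N.
    apply: mindl; rewrite rgt0 /=; apply/eqP.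
    by rewrite -[in RHS]xk {2}(divn_eq k dl) expnD exprM xmul.
  by rewrite leqNgt ltn_mod dl0.
have uc : uniq (conjugates dl x).
  rewrite map_inj_in_uniq ?iota_uniq // => i j; rewrite !mem_iota !add0n /=.
  wlog leij : i j / (i <= j)%N.
    by move=> H; have [/H//|/ltnW /H H' ? ? /esym e] := leqP i j; apply/esym/H'.
  move=> lti ltj e; apply/eqP; rewrite eqn_leq leij /= -subn_eq0.
  case: posnP => // ji0.
  have : (dl <= j - i)%N.
    apply: mindl; rewrite ji0 /=; apply/eqP; apply: (@expr_Frob_inj i).
    by rewrite -exprM -expnD subnK.
  by lia.
have conjM j : conjpoly (j * dl) x = conjpoly dl x ^+ j.
  elim: j => [|j IHj].
    rewrite mul0n expr0; apply: (map_inj_poly (fmorph_inj io)); rewrite ?rmorph0 //.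
    by rewrite conjpolyE ?expr1 // big_nil rmorph1.
  rewrite exprS -IHj; apply: (map_inj_poly (fmorph_inj io)); rewrite ?rmorph0 //.
  rewrite rmorphM /= !conjpolyE // mulSn /conjugates iotaD map_cat big_cat; congr (_ * _).
  rewrite add0n -[X in iota X](addn0 dl) iotaDl -map_comp.
  by congr bigop; apply: eq_map => i /=; rewrite expnD exprM xdl.
have dva : conjpoly dl x ^+ a %| P.
  rewrite -(dvdp_map io) rmorphXn /= conjpolyE //.
  apply: prod_XsubC_expn_dvdp => // _ /mapP[i _ ->]; apply: dvdp_conj.
  by rewrite -mup_geq.
have le_adl : (a * dl <= n)%N.
  have := dvdp_leq P0 dva; rewrite -conjM size_conjpoly // /n.
  by case: (size P).
have dvdE j : (conjpoly (j * dl) x %| P) = (j <= a)%N.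
  apply/idP/idP => [|leja]; last first.
    by rewrite conjM; apply: dvdp_trans dva; apply: dvdp_exp2l.
  rewrite conjM mup_geq // -(dvdp_map io) rmorphXn /= conjpolyE //.
  apply: dvdp_trans; apply: dvdp_exp2r; rewrite dvdp_XsubCl root_prod_XsubC.
  by apply/mapP; exists 0%N; rewrite ?mem_iota ?expr1.
rewrite -big_mkcond sum1_count.
rewrite -[RHS](size_iota 1) -(size_map (muln^~ dl)) -size_filter.
apply: perm_size; apply: uniq_perm; first by rewrite filter_uniq ?iota_uniq.
  rewrite map_inj_uniq ?iota_uniq // => i j /eqP; rewrite eqn_pmul2r // => /eqP//.
move=> k; rewrite mem_filter mem_index_iota fixedE; apply/idP/mapP.
  case/andP => /andP[/dvdnP[j ->]]; rewrite dvdE => leja /andP[j0 _].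
  exists j => //; rewrite mem_iota add1n ltnS leja andbT.
  by move: j0; rewrite muln_gt0 => /andP[].
move=> [j]; rewrite mem_iota add1n ltnS => /andP[j0 leja] ->.
rewrite dvdn_mull //= dvdE leja muln_gt0 j0 dl0 ltnS /=.
by apply: leq_trans le_adl; rewrite leq_mul2r leja orbT.
Qed.

End Root.

(** The polynomial analogue of log n as the sum over divisors of the von Mangoldt function: a root
    of multiplicity m is counted for exactly m values of k. *)
Lemma sum_count_conjpoly (P : {poly 'F_p}) : P \is monic ->
  (\sum_(1 <= k < size P) count (fun x => conjpoly k x %| P)%R (Fpn p K k) = (size P).-1)%N.
Proof.
move=> mP; have P0 := monic_neq0 mP.
have [rs PE] := closed_field_poly_normal (map_poly io P).
rewrite lead_coef_map (monicP mP) rmorph1 scale1r in PE.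
have srs : size rs = (size P).-1.
  by rewrite -(size_map_poly io) PE size_prod_XsubC.
have -> : (\sum_(1 <= k < size P) count (fun x => conjpoly k x %| P)%R (Fpn p K k) =
  \sum_(1 <= k < size P) \sum_(x <- undup rs) ((x ^+ (p ^ k) == x)%R && (conjpoly k x %| P)%R))%N.
  apply: eq_big_nat => k /andP[k0 _].
  rewrite -big_mkcond sum1_count -2!size_filter; apply: perm_size.
  apply: uniq_perm; rewrite ?filter_uniq ?undup_uniq ?uniq_Fpn // => x.
  rewrite !mem_filter (mem_Fpn p_pr) // mem_undup andbC.
  case: eqP => //= xk; case dv: (_ %| _) => //=; apply/esym.
  rewrite -root_prod_XsubC -PE -dvdp_XsubCl.
  rewrite -(dvdp_map io) in dv; apply: dvdp_trans dv; rewrite conjpolyE //.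
  rewrite dvdp_XsubCl root_prod_XsubC.
  by apply/mapP; exists 0%N; rewrite ?mem_iota ?expr1.
rewrite exchange_big /= -srs.
have -> : size rs = (\sum_(x <- undup rs) iterop (count_mem x rs) addn 1 0)%N.
  by rewrite big_undup_iterop_count sum1_size.
apply: eq_big_seq => x; rewrite mem_undup => xrs.
have := @count_conjpoly_dvd P x P0; rewrite prednK ?size_poly_gt0 // => ->; last first.
  by rewrite PE root_prod_XsubC.
rewrite PE mu_prod_XsubC; case: count => // m.
by rewrite iteropS iter_addn mul1n addn1.
Qed.

End Conjugates.

(** * Newton's identities and the size of the bases of power sums *)

Section Newton.

Variable F : comNzRingType.
Implicit Types (ws : seq F) (w : F).

(* The coefficient of T^n in the product of the 1 - w T. *)
Fixpoint rev_coef ws n : F :=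
  if ws is w :: ws' then rev_coef ws' n - w * (if n is m.+1 then rev_coef ws' m else 0)
  else (n == 0%N)%:R.
Arguments rev_coef ws n%_nat_scope.

Lemma rev_coef0 ws : rev_coef ws 0 = 1.
Proof. by elim: ws => //= w ws ->; rewrite mulr0 subr0. Qed.

Lemma rev_coefE ws n : rev_coef ws n =
  if (n <= size ws)%N then (\prod_(w <- ws) ('X - w%:P))`_(size ws - n) else 0.
Proof.
elim: ws n => [|w ws IHws] n.
  by rewrite big_nil leqn0 coef1 sub0n /=; case: eqP.
rewrite big_cons mulrBl mul_polyC coefB coefZ coefXM /=.
case: n => [|n]; last rewrite !IHws ltnS.
  rewrite rev_coef0 mulr0 subr0 subn0 /= [X in w * X]nth_default ?size_prod_XsubC //.
  rewrite mulr0 subr0.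
  have := monicP (monic_prod_XsubC ws predT id); rewrite lead_coefE size_prod_XsubC => /= ->.
  by [].
rewrite subSS; case: (ltngtP n (size ws)) => [ltn|ltn|->].
- by rewrite subn_eq0 leqNgt ltn /= subnS.
- by rewrite mulr0 subr0.
by rewrite subnn eqxx.
Qed.

Lemma newton ws n :
  n.+1%:R * rev_coef ws n.+1 = - \sum_(k < n.+1) (\sum_(w <- ws) w ^+ k.+1) * rev_coef ws (n - k).
Proof.
elim: ws n => [|w ws IHws] n /=.
  by rewrite mulr0 big1 ?oppr0 // => k _; rewrite big_nil mul0r.
have IH0 m : m%:R * rev_coef ws m =
    - \sum_(k < m) (\sum_(w <- ws) w ^+ k.+1) * rev_coef ws (m.-1 - k).
  by case: m => [|m]; [rewrite mul0r big_ord0 oppr0 | exact: IHws].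
have -> : \sum_(k < n.+1) (\sum_(y <- w :: ws) y ^+ k.+1) *
    (rev_coef ws (n - k) - w * (if (n - k)%N is m.+1 then rev_coef ws m else 0)) =
  \sum_(k < n.+1) (\sum_(y <- w :: ws) y ^+ k.+1) * rev_coef ws (n - k) -
  w * \sum_(k < n) (\sum_(y <- w :: ws) y ^+ k.+1) * rev_coef ws (n.-1 - k).
  under eq_bigr => k _ do rewrite mulrBr.
  rewrite sumrB; congr (_ - _); rewrite big_ord_recr /= subnn !mulr0 addr0 mulr_sumr.
  apply: eq_bigr => k _; rewrite mulrCA; congr (w * (_ * _)).
  have -> : (n - k = (n.-1 - k).+1)%N by have := ltn_ord k; lia.
  by [].
have split_sum m j : \sum_(k < m) (\sum_(y <- w :: ws) y ^+ k.+1) * rev_coef ws (j - k) =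
    \sum_(k < m) w ^+ k.+1 * rev_coef ws (j - k) +
    \sum_(k < m) (\sum_(y <- ws) y ^+ k.+1) * rev_coef ws (j - k).
  by rewrite -big_split; apply: eq_bigr => k _; rewrite big_cons mulrDl.
rewrite !split_sum.
have -> : \sum_(k < n.+1) (\sum_(y <- ws) y ^+ k.+1) * rev_coef ws (n - k) =
    - (n.+1%:R * rev_coef ws n.+1) by rewrite IHws opprK.
have -> : \sum_(k < n) (\sum_(y <- ws) y ^+ k.+1) * rev_coef ws (n.-1 - k) =
    - (n%:R * rev_coef ws n) by rewrite IH0 opprK.
have -> : \sum_(k < n.+1) w ^+ k.+1 * rev_coef ws (n - k) =
    w * rev_coef ws n + w * \sum_(k < n) w ^+ k.+1 * rev_coef ws (n.-1 - k).
  rewrite big_ord_recl /= subn0 expr1 mulr_sumr; congr (_ + _); apply: eq_bigr => k _.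
  rewrite /bump /= add1n exprS mulrA; congr (_ * rev_coef ws _); lia.
by rewrite -natr1; ring.
Qed.

End Newton.

(** By the recurrence, the polynomial L(T) with coefficients c_n satisfies L' = L times the series
    of the s_(n+1) T^n. Q is T^d L(1/T), and its roots are the inverse roots of L padded with
    zeros. *)
Lemma newton_powersums (F : closedFieldType) (c s : nat -> F) d :
  c 0%N = 1 -> (forall n, (d < n)%N -> c n = 0) ->
  (forall n, n.+1%:R * c n.+1 = \sum_(k < n.+1) s k.+1 * c (n - k)%N) ->
  exists2 ws : seq F, size ws = d & forall n, s n.+1 = - \sum_(w <- ws) w ^+ n.+1.
Proof.
move=> c0 cd cs; pose Q := \poly_(i < d.+1) c (d - i)%N.
have lQ : Q`_d = 1 by rewrite coef_poly ltnSn subnn c0.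
have sQ : size Q = d.+1.
  apply/eqP; rewrite eqn_leq size_poly ltnNge; apply/negP => /(nth_default 0).
  by rewrite lQ => /eqP; rewrite oner_eq0.
have [ws QE] := closed_field_poly_normal Q.
rewrite lead_coefE sQ lQ scale1r in QE.
have sws : size ws = d by move: sQ; rewrite QE size_prod_XsubC => -[].
exists ws => //.
have cE n : c n = rev_coef ws n.
  rewrite rev_coefE sws -QE; case: leqP => [len|/cd //].
  by rewrite coef_poly ltnS leq_subr subKn.
elim/ltn_ind => n IHn.
have := newton ws n; rewrite -cE cs !big_ord_recr /= subnn -cE c0 !mulr1 opprD -sumrN.
have -> : \sum_(i < n) s i.+1 * c (n - i)%N =
    \sum_(i < n) - ((\sum_(w <- ws) w ^+ i.+1) * rev_coef ws (n - i)%N).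
  by apply: eq_bigr => i _; rewrite IHn // cE mulNr.
exact: addrI.
Qed.

Section PowerSumBound.

Variables (C : numClosedFieldType) (archi : Num.archimedean_axiom C).

Lemma expr_bounded_le1 (x b : C) k0 : 0 <= x ->
  (forall k, (k0 <= k)%N -> x ^+ k <= b) -> x <= 1.
Proof.
move=> x0 xb; have xr : x \is Num.real by rewrite ger0_real.
case: (real_leP xr (rpred1 _)) => // x1.
(* Bernoulli's inequality: with x > 1 the powers would outgrow b. *)
have bern k : 1 + k%:R * (x - 1) <= x ^+ k.
  elim: k => [|k IHk]; first by rewrite mul0r addr0 expr0.
  rewrite exprS; apply: le_trans (ler_wpM2l x0 IHk).
  rewrite -subr_ge0.
  have -> : x * (1 + k%:R * (x - 1)) - (1 + k.+1%:R * (x - 1)) = k%:R * (x - 1) ^+ 2.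
    by rewrite -natr1; ring.
  by rewrite mulr_ge0 // exprn_ge0 // subr_ge0 ltW.
have d0 : 0 < x - 1 by rewrite subr_gt0.
have [n ltn] := archi (b / (x - 1)).
have b0 : 0 <= b by apply: le_trans (xb k0 (leqnn _)); rewrite exprn_ge0.
rewrite ger0_norm ?divr_ge0 ?(ltW d0) // ltr_pdivrMr // in ltn.
have := le_trans (bern (maxn n k0)) (xb _ (leq_maxr _ _)).
have : n%:R * (x - 1) <= (maxn n k0)%:R * (x - 1).
  by rewrite ler_wpM2r ?ler_nat ?leq_maxl // ltW.
move=> h1 h2; have := le_lt_trans (le_trans (lerD (lexx 1) h1) h2) ltn.
by rewrite gtrDr => /lt_geF; rewrite ler01.
Qed.

(* Lagrange interpolation isolates one base of the power sums. *)
Lemma powersum_bound (ws : seq C) (r : C) (B k0 : nat) : 0 < r ->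
  (forall k, (k0 <= k)%N -> `|\sum_(w <- ws) w ^+ (2 * k)| <= B%:R * r ^+ k) ->
  forall w, w \in ws -> `|w| ^+ 2 <= r.
Proof.
(* Only even power sums are controlled, so the bases are squared, then scaled to make the bound
   constant. *)
move=> r0 bnd w wws; pose nu := [seq w ^+ 2 / r | w <- ws].
have nuk k : (k0 <= k)%N -> `|\sum_(y <- nu) y ^+ k| <= B%:R.
  move=> /bnd; rewrite -ler_pdivrMr ?exprn_gt0 //; apply: le_trans.
  rewrite -[in leRHS](ger0_norm (exprn_ge0 k (ltW r0))) -normf_div big_map mulr_suml.
  by under eq_bigr => y _ do rewrite expr_div_n -exprM.
pose y := w ^+ 2 / r; have ynu : y \in nu by apply: map_f.
pose L := \prod_(z <- rem y (undup nu)) ('X - z%:P).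
have Ly : L.[y] != 0.
  by rewrite -/(root L y) root_prod_XsubC mem_rem_uniq ?undup_uniq // inE eqxx.
have Lz z : z \in nu -> z != y -> L.[z] = 0.
  move=> znu zy; apply/eqP; rewrite -/(root L z) root_prod_XsubC.
  by rewrite mem_rem_uniq ?undup_uniq // inE zy mem_undup.
have sumL k : \sum_(t < size L) L`_t * \sum_(z <- nu) z ^+ (k + t) =
    (count_mem y nu)%:R * (y ^+ k * L.[y]).
  transitivity (\sum_(z <- nu) z ^+ k * L.[z]).
    under eq_bigr => t _ do rewrite mulr_sumr.
    rewrite exchange_big; apply: eq_bigr => z _; rewrite horner_coef mulr_sumr.
    by apply: eq_bigr => t _; rewrite exprD mulrCA.
  rewrite -sum1_count natr_sum mulr_suml [RHS]big_mkcond.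
  apply: eq_big_seq => z znu /=; case: eqVneq => [->|/(Lz z znu)->]; first by rewrite mul1r.
  by rewrite mulr0.
pose S := \sum_(t < size L) `|L`_t| * B%:R.
have : `|y| <= 1.
  apply: (@expr_bounded_le1 _ (S / `|L.[y]|) k0) => // k lek.
  rewrite ler_pdivlMr ?normr_gt0 // -normrX -normrM.
  (* Equal bases enter with a positive multiplicity, so they cannot cancel. *)
  have m1 : 1 <= (count_mem y nu)%:R :> C by rewrite ler1n -has_count has_pred1.
  apply: le_trans (ler_peMl (normr_ge0 _) m1) _.
  rewrite -[(count_mem y nu)%:R]normr_nat -normrM -sumL.
  apply: le_trans (ler_norm_sum _ _ _) _; apply: ler_sum => t _.
  by rewrite normrM ler_wpM2l // nuk // (leq_trans lek) // leq_addr.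
by rewrite /y normf_div normrX (ger0_norm (ltW r0)) ler_pdivrMr // mul1r.
Qed.

End PowerSumBound.

(** * L-series of multiplicative functions on monic polynomials *)

Section MonicSums.

Variables (F : finFieldType) (C : comNzRingType) (Lam : {poly F} -> C).
Hypothesis LamM : forall P Q, P \is monic -> Q \is monic -> Lam (P * Q) = Lam P * Lam Q.

Definition monic_of d (r : 'rV[F]_d) : {poly F} := 'X^d + rVpoly r.

Lemma monic_ofP d (r : 'rV[F]_d) : monic_of r \is monic /\ size (monic_of r) = d.+1.
Proof.
have lt : (size (rVpoly r) < size ('X^d : {poly F}))%N.
  by rewrite size_polyXn ltnS size_poly.
split; last by rewrite /monic_of size_polyDl // size_polyXn.
by rewrite monicE /monic_of lead_coefDl // lead_coefXn.
Qed.

Lemma monic_of_surj d (P : {poly F}) : P \is monic -> size P = d.+1 ->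
  monic_of (poly_rV (P - 'X^d) : 'rV_d) = P.
Proof.
move=> mP sP; rewrite /monic_of poly_rV_K; first by rewrite addrC subrK.
by have := size_monic_tail mP; rewrite sP.
Qed.

Lemma monic_of_inv d (r : 'rV[F]_d) : poly_rV (monic_of r - 'X^d) = r.
Proof. by rewrite /monic_of addrAC subrr add0r rVpolyK. Qed.

(** The coefficient of T^d in the L-series of [Lam]. *)
Definition monic_sum d := \sum_(r : 'rV[F]_d) Lam (monic_of r).

Lemma monic_sum_multiples n k (N : {poly F}) : N \is monic -> size N = k.+1 -> (k <= n)%N ->
  \sum_(r : 'rV[F]_n | N %| monic_of r) Lam (monic_of r) = Lam N * monic_sum (n - k).
Proof.
move=> mN sN lekn; have N0 := monic_neq0 mN.
pose h (r : 'rV[F]_(n - k)) : 'rV[F]_n := poly_rV (N * monic_of r - 'X^n).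
pose h' (r : 'rV[F]_n) : 'rV[F]_(n - k) := poly_rV (monic_of r %/ N - 'X^(n - k)).
have hE r : monic_of (h r) = N * monic_of r.
  have [m1 s1] := monic_ofP r; apply: monic_of_surj; first by rewrite monicMl.
  by rewrite size_mul ?monic_neq0 // sN s1 addSn addnS /= subnKC.
rewrite /monic_sum mulr_sumr (reindex_onto h h') /=.
  apply: eq_big => r.
    by rewrite hE dvdp_mulr //= /h' hE mulKp // monic_of_inv eqxx.
  by move=> _; rewrite hE LamM //; case: (monic_ofP r).
move=> r dv; have [m1 s1] := monic_ofP r.
have qE : monic_of r = N * (monic_of r %/ N) by rewrite mulrC divpK.
have mq : monic_of r %/ N \is monic by move: m1; rewrite {1}qE monicMl.
have sq : size (monic_of r %/ N) = (n - k).+1.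
  by rewrite size_divp // s1 sN /= subSn.
by rewrite /h monic_of_surj // -qE monic_of_inv.
Qed.

End MonicSums.

Section LFunction.

Variables (p : nat) (K : closedFieldType) (io : {rmorphism 'F_p -> K}).
Hypothesis p_pr : prime p.
Variables (C : numClosedFieldType) (psi eta : 'F_p -> C).
Hypotheses (psiD : forall a b, psi (a + b) = psi a * psi b) (psi0 : psi 0 = 1).
Hypotheses (etaM : forall a b, eta (a * b) = eta a * eta b) (eta1 : eta 1 = 1).
Variables (b a c s : 'F_p).

Let charK : p \in [pchar K].
Proof. exact: (rmorph_pchar io (pchar_Fp p_pr)). Qed.

(* For P = prod (X - x_i) with all P.[0], P.[s] nonzero, this is
   eta (prod x_i) psi (sum (b x_i + a / (x_i - s) + c / x_i)). *)
Definition Lambda (P : {poly 'F_p}) : C :=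
  if (P.[0] == 0) || (P.[s] == 0) then 0 else
  eta ((-1) ^+ (size P).-1 * P.[0]) *
  psi (- (b * subcoef P + a * dlog s P + c * dlog 0 P)).

Lemma LambdaM P Q : P \is monic -> Q \is monic -> Lambda (P * Q) = Lambda P * Lambda Q.
Proof.
move=> mP mQ; rewrite /Lambda !hornerM !mulf_eq0.
have [P0|P0] := eqVneq P.[0] 0; first by rewrite /= mul0r.
have [Q0|Q0] := eqVneq Q.[0] 0; first by rewrite /= mulr0.
have [Ps|Ps] := eqVneq P.[s] 0; first by rewrite /= mul0r.
have [Qs|Qs] := eqVneq Q.[s] 0; first by rewrite /= mulr0.
rewrite /= subcoefM // !dlogM //.
have -> : (size (P * Q)).-1 = ((size P).-1 + (size Q).-1)%N.
  rewrite size_mul ?monic_neq0 //.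
  have : (0 < size P)%N by rewrite size_poly_gt0 monic_neq0.
  have : (0 < size Q)%N by rewrite size_poly_gt0 monic_neq0.
  by move: (size P) (size Q) => m n; lia.
rewrite exprD mulrACA etaM mulrACA -psiD; congr (_ * psi _); ring.
Qed.

Lemma Lambda1 : Lambda 1 = 1.
Proof.
rewrite /Lambda !hornerC oner_eq0 size_poly1 expr0 mulr1 eta1 subcoef1 !dlog1.
by rewrite !mulr0 !addr0 oppr0 psi0 mulr1.
Qed.

(** The roots are the conjugates of x, so up to sign the constant term is the norm of x, while the
    subleading coefficient and the logarithmic derivatives at s and 0 are the traces of x, 1 / (x -
    s) and 1 / x. *)
Lemma Lambda_conjpoly n x : x ^+ (p ^ n) = x -> (0 < n)%N ->
  Lambda (conjpoly io n x) =
  if (x == 0) || (x == io s) then 0 else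
  eta (inFp io (nmFp p n x)) *
  psi (inFp io (trFp p n (io b * x + io a / (x - io s) + io c / x))).
Proof.
move=> xn n0; set P := conjpoly io n x.
have PE : map_poly io P = \prod_(z <- conjugates p n x) ('X - z%:P) by apply: conjpolyE.
have ioX i z : io z = io z ^+ (p ^ i) by rewrite io_Frob.
have memE z : (io z \in conjugates p n x) = (x == io z).
  apply/mapP/eqP => [[i _]|->]; last by exists 0%N; rewrite ?mem_iota ?expr1.
  by rewrite {1}(ioX i) => /(expr_Frob_inj io p_pr) ->.
have rootE z : (P.[z] == 0) = (x == io z).
  by rewrite -(fmorph_eq0 io) -horner_map PE -memE -root_prod_XsubC.
rewrite /Lambda !rootE rmorph0; case: ifP => // /negbT; rewrite negb_or => /andP[x0 xs].
have szP : (size P).-1 = n by rewrite size_conjpoly.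
have sumE (f : K -> K) : \sum_(y <- conjugates p n x) f y = \sum_(i < n) f (x ^+ (p ^ i)).
  by rewrite big_map -[X in iota _ X]subn0 -/(index_iota 0 n) big_mkord.
congr (eta _ * psi _); apply: (fmorph_inj io); rewrite inFpK //.
- rewrite rmorphM rmorphXn rmorphN1 -horner_map rmorph0 PE horner_prod szP.
  rewrite /nmFp big_map -[X in iota _ X]subn0 -/(index_iota 0 n) big_mkord.
  under eq_bigr => i _ do rewrite hornerXsubC sub0r.
  rewrite prodrN card_ord mulrA -exprMn mulrNN mulr1 expr1n mul1r //.
- exact: nmFp_fixed.
- have lin u1 u2 u3 : io (- (b * u1 + a * u2 + c * u3)) =
      - (io b * io u1 + io a * io u2 + io c * io u3).
    by rewrite rmorphN !rmorphD !rmorphM.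
  rewrite lin -subcoef_map -!dlog_map PE subcoef_prod.
  rewrite !dlog_prod ?memE ?rmorph0 // !sumE -sumrN.
  rewrite /trFp !mulr_sumr -!big_split -sumrN; apply: eq_bigr => i _ /=.
  rewrite !(exprD_Frob charK) !exprMn !exprVn (exprD_Frob charK) (exprN_Frob charK) -!ioX.
  by rewrite -[io s - _]opprB sub0r !invrN; ring.
apply: (trFp_fixed io p_pr) => //.
rewrite !(exprD_Frob charK) !exprMn !exprVn -!(ioX n) xn (exprD_Frob charK) (exprN_Frob charK).
by rewrite xn -ioX.
Qed.

Let cd := monic_sum Lambda.

Lemma monic_sum_Lambda0 : cd 0 = 1.
Proof.
rewrite /cd /monic_sum (eq_bigr (fun _ => 1)).
  by rewrite sumr_const card_mx muln0 expn0.
move=> r _; rewrite /monic_of expr0 (_ : rVpoly r = 0) ?addr0 ?Lambda1 //.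
by apply/eqP; rewrite -size_poly_eq0 -leqn0 size_poly.
Qed.

Hypotheses (b0 : b != 0) (psi_nt : exists z, psi z != 1).

(* Adding a multiple of X^(d-3) (X - s)^2 to P only changes the argument of
   psi, through the subleading coefficient. *)
Lemma monic_sum_Lambda_eq0 d : (4 < d)%N -> cd d = 0.
Proof.
move=> d4; have [z psiz] := psi_nt.
(* d > 4 makes d - 3 >= 2, so W has double zeros at 0 and at s; this preserves values and
   logarithmic derivatives at both points. *)
pose W : {poly 'F_p} := 'X^(d - 3) * ('X - s%:P) ^+ 2.
have sW : size W = d.
  rewrite size_mul ?monic_neq0 ?monicXn ?monic_exp ?monicXsubC //.
  rewrite size_polyXn size_exp_XsubC; lia.
have mW : W \is monic by rewrite monicMl ?monicXn ?monic_exp ?monicXsubC.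
have dbl (y : 'F_p) V : W = ('X - y%:P) ^+ 2 * V -> W.[y] = 0 /\ W^`().[y] = 0.
  move=> ->; rewrite expr2 !derivM derivXsubC !(hornerM, hornerD, hornerN, hornerX, hornerC) subrr.
  by rewrite !(mul0r, mulr0, addr0).
have Wz y : (y == 0) || (y == s) -> W.[y] = 0 /\ W^`().[y] = 0.
  case/orP => /eqP->; last by apply: (dbl _ 'X^(d - 3)); rewrite mulrC.
  apply: (dbl _ ('X^(d - 5) * ('X - s%:P) ^+ 2)); rewrite subr0 mulrA -exprD /W.
  by congr ('X^_ * _); lia.
(* The subleading coefficient moves by t, so the argument of psi moves by - b t = z. *)
pose t := - (z / b).
have shift (r : 'rV_d) : Lambda (monic_of (r + poly_rV (t *: W))) = psi z * Lambda (monic_of r).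
  have [m1 s1] := monic_ofP r; have [m2 s2] := monic_ofP (r + poly_rV (t *: W)).
  have E : monic_of (r + poly_rV (t *: W)) = monic_of r + t *: W.
    rewrite /monic_of raddfD /= poly_rV_K ?addrA //.
    by apply: leq_trans (size_scale_leq _ _) _; rewrite sW.
  have [W0 W'0] := Wz 0 (introT orP (or_introl (eqxx _))).
  have [Ws W's] : W.[s] = 0 /\ W^`().[s] = 0 by apply: Wz; rewrite eqxx orbT.
  rewrite /Lambda s1 s2 E /dlog derivD derivZ !hornerD !hornerZ W0 W'0 Ws W's !mulr0 !addr0.
  case: ifP => _; first by rewrite mulr0.
  rewrite [RHS]mulrCA -psiD; congr (_ * psi _).
  have -> : subcoef (monic_of r + t *: W) = subcoef (monic_of r) + t.
    rewrite /subcoef -E s1 s2 E /=.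
    rewrite (_ : _ - _ = (monic_of r - 'X^d) + t *: W); last by rewrite addrAC.
    rewrite [LHS]coefD coefZ; congr (_ + _).
    by move: (monicP mW); rewrite lead_coefE sW => ->; rewrite mulr1.
  rewrite mulrDr /t; have -> : b * - (z / b) = - z by field.
  by ring.
have : cd d = psi z * cd d.
  rewrite /cd /monic_sum mulr_sumr (reindex_inj (addIr (poly_rV (t *: W)))) /=.
  by apply: eq_bigr => r _; rewrite shift.
move/eqP; rewrite -subr_eq0 -[X in X - _]mul1r -mulrBl mulf_eq0 subr_eq0 eq_sym.
by rewrite (negbTE psiz) => /eqP.
Qed.

Definition conjsum n := \sum_(x <- Fpn p K n) Lambda (conjpoly io n x).

(** The logarithmic derivative of the Euler product: the degree n + 1 of P is written as the number
    of pairs (k, x) whose [conjpoly] divides P, then the sum over the multiples P of each is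
    taken. *)
Lemma monic_sum_rec n :
  n.+1%:R * cd n.+1 = \sum_(k < n.+1) conjsum k.+1 * cd (n - k).
Proof.
have -> : n.+1%:R * cd n.+1 = \sum_(r : 'rV['F_p]_n.+1)
    \sum_(1 <= k < n.+2) \sum_(x <- Fpn p K k | conjpoly io k x %| monic_of r) Lambda (monic_of r).
  rewrite /cd /monic_sum mulr_sumr; apply: eq_bigr => r _.
  have [mr sr] := monic_ofP r.
  have cnt := sum_count_conjpoly io p_pr mr; rewrite sr /= in cnt.
  rewrite -[X in X%:R]cnt.
  rewrite natr_sum mulr_suml; apply: eq_bigr => k _.
  by rewrite -sum1_count natr_sum mulr_suml; apply: eq_bigr => x _; rewrite mul1r.
rewrite exchange_big big_add1 /= big_mkord; apply: eq_bigr => k _.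
under eq_bigr => r _ do rewrite big_mkcond.
rewrite exchange_big /conjsum mulr_suml big_seq [RHS]big_seq; apply: eq_bigr => x.
rewrite (mem_Fpn p_pr) // => /eqP xk; rewrite -big_mkcond.
rewrite (@monic_sum_multiples _ _ _ LambdaM _ k.+1); first by rewrite subSS.
- exact: conjpoly_monic.
- exact: size_conjpoly.
- exact: ltn_ord.
Qed.

Lemma conjsum_powersums : exists2 ws : seq C, size ws = 4 &
  forall n, conjsum n.+1 = - \sum_(w <- ws) w ^+ n.+1.
Proof.
apply: (newton_powersums monic_sum_Lambda0 monic_sum_Lambda_eq0).
exact: monic_sum_rec.
Qed.

End LFunction.

(** * Weil's bound *)

Definition legendre (C : pzRingType) (p : nat) (x : 'F_p) : C :=
  if x == 0 then 0 else if x ^+ p.-1./2 == 1 then 1 else -1.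

Section Legendre.

Variables (C : pzRingType) (p : nat).
Hypotheses (p_pr : prime p) (p_odd : odd p).
Local Notation chi := (@legendre C p).

Lemma Fp_half_exp (x : 'F_p) : x != 0 -> (x ^+ p.-1./2 == 1) || (x ^+ p.-1./2 == -1).
Proof.
move=> x0; rewrite -eqf_sqr expr1n -exprM muln2 halfK.
have -> : odd p.-1 = false by case: p p_odd p_pr => //= q /negbTE.
rewrite subn0 -(inj_eq (mulfI x0)) mulr1 -exprS prednK ?prime_gt0 //.
by have := Fp_expX 1 x p_pr; rewrite expn1 => ->.
Qed.

Lemma Fp_N1_neq1 : (-1 : 'F_p) != 1.
Proof.
rewrite eq_sym -addr_eq0 -mulr2n -(dvdn_pcharf (pchar_Fp p_pr)).
by rewrite dvdn_prime2 //; apply: contraL p_odd => /eqP->.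
Qed.

Lemma legendre1 : chi 1 = 1.
Proof. by rewrite /legendre oner_eq0 expr1n eqxx. Qed.

Lemma legendreM x y : chi (x * y) = chi x * chi y.
Proof.
rewrite /legendre mulf_eq0.
have [->|x0] := eqVneq x 0; first by rewrite /= !mul0r.
have [->|y0] := eqVneq y 0; first by rewrite orbT !mulr0.
rewrite /= exprMn; have N1 := negbTE Fp_N1_neq1.
case/orP: (Fp_half_exp x0) => /eqP->; case/orP: (Fp_half_exp y0) => /eqP->;
by rewrite ?mulrNN ?mul1r ?mulr1 ?eqxx ?N1 ?mulrNN ?mul1r ?mulr1.
Qed.

End Legendre.

Section SquareCount.

Variables (p : nat) (K : closedFieldType) (io : {rmorphism 'F_p -> K}) (C : comNzRingType).
Hypotheses (p_pr : prime p) (p_odd : odd p).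
Let charK : p \in [pchar K].
Proof. exact: (rmorph_pchar io (pchar_Fp p_pr)). Qed.
Local Notation chi := (@legendre C p).

(** A telescoping product. It is applied to a square root z of an element of F_(p^n), where z^(p^n)
    / z tells whether z belongs to F_(p^n). *)
Lemma nmFp_exp n (z : K) : z != 0 -> nmFp p n z ^+ p.-1 = z ^+ (p ^ n) / z.
Proof.
move=> z0; have N0 : nmFp p n z != 0.
  by rewrite prodf_seq_neq0; apply/allP => i _; rewrite expf_neq0.
apply: (mulIf N0); rewrite -exprSr prednK ?prime_gt0 //.
rewrite /nmFp -prodrXl.
under eq_bigr => i _ do rewrite -exprM -expnSr.
apply: (mulIf z0); rewrite mulrAC mulfVK // [LHS]mulrC.
transitivity (\prod_(i < n.+1) z ^+ (p ^ i)).
  by rewrite big_ord_recl expr1.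
by rewrite big_ord_recr mulrC.
Qed.

(** For x = z^2 the norm of x raised to (p - 1) / 2 is z^(p^n) / z, which is 1 exactly when z is in
    F_(p^n); so chi of the norm is the quadratic character of F_(p^n). *)
Lemma legendre_nmFp n (x : K) : (0 < n)%N -> x \in Fpn p K n -> x != 0 ->
  1 + chi (inFp io (nmFp p n x)) = (count (fun z => z ^+ 2 == x) (Fpn p K n))%:R.
Proof.
move=> n0 xn x0; have xQ : x ^+ (p ^ n) = x by apply/eqP; rewrite -mem_Fpn.
have /closed_rootP[z /rootP zr] : size ('X^2 - x%:P)%R != 1.
  by rewrite size_polyDl size_polyXn // size_polyN size_polyC x0.
have z2 : z ^+ 2 = x by move/eqP: zr; rewrite !hornerE subr_eq0 => /eqP.
have z0 : z != 0 by apply: contraNneq x0 => z0; rewrite -z2 z0 expr0n.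
set y := inFp io _.
have yE : io y = nmFp p n x by rewrite inFpK // nmFp_fixed.
have y0 : y != 0.
  rewrite -(fmorph_eq0 io) yE prodf_seq_neq0; apply/allP => i _.
  by rewrite expf_neq0.
have yh : io (y ^+ p.-1./2) = z ^+ (p ^ n) / z.
  rewrite rmorphXn yE -nmFp_exp //.
  have -> : nmFp p n x = nmFp p n z ^+ 2.
    by rewrite /nmFp -prodrXl; apply: eq_bigr => i _; rewrite -z2 -!exprM mulnC.
  rewrite -exprM mul2n halfK; congr (_ ^+ _).
  by case: p p_odd p_pr => //= q /negbTE -> _; rewrite subn0.
have zmem : (z \in Fpn p K n) = (y ^+ p.-1./2 == 1).
  rewrite mem_Fpn // -[RHS](inj_eq (fmorph_inj io)) rmorph1 yh.
  by rewrite -[RHS](inj_eq (mulIf z0)) mulfVK // mul1r.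
have zN : z != - z.
  rewrite -addr_eq0 -mulr2n -mulr_natr mulf_neq0 //.
  rewrite -(dvdn_pcharf charK) dvdn_prime2 //.
  by apply: contraL p_odd => /eqP->.
have Nzmem : (- z \in Fpn p K n) = (z \in Fpn p K n).
  by rewrite !mem_Fpn // (exprN_Frob charK) eqr_opp.
have cE : count (fun w => w ^+ 2 == x) (Fpn p K n) =
    ((z \in Fpn p K n) + (- z \in Fpn p K n))%N.
  rewrite -!count_uniq_mem ?(uniq_Fpn io) //.
  rewrite -count_predUI [X in (_ + X)%N](_ : _ = 0%N) ?addn0.
    by apply: eq_count => w /=; rewrite -z2 eqf_sqr.
  rewrite (eq_count (a2 := pred0)) ?count_pred0 // => w /=.
  by case: (eqVneq w z) => //= ->; apply/negbTE.
rewrite cE Nzmem zmem /legendre (negbTE y0); case: ifP => _ //.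
by rewrite subrr.
Qed.

End SquareCount.

Section WeilBound.

Variables (p : nat) (C : numClosedFieldType) (psi : 'F_p -> C).
Hypotheses (p_pr : prime p) (p_odd : odd p) (archi : Num.archimedean_axiom C).
Hypotheses (psiD : forall a b, psi (a + b) = psi a * psi b).
Hypotheses (psi_norm : forall a, `|psi a| = 1) (psi_nt : exists z, psi z != 1).
Variables (a b c s : 'F_p).
Hypothesis b0 : b != 0.

Lemma add_char0 : psi 0 = 1.
Proof.
have n0 : psi 0 != 0 by rewrite -normr_eq0 psi_norm oner_eq0.
by apply: (mulIf n0); rewrite mul1r -psiD addr0.
Qed.

Lemma add_char_sum : \sum_x psi x = 0.
Proof.
have [z pz] := psi_nt; apply/eqP.
have : \sum_x psi x = psi z * \sum_x psi x.
  rewrite mulr_sumr (reindex_inj (addrI z)) /=.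
  by apply: eq_bigr => x _; rewrite psiD.
move/eqP; rewrite -subr_eq0 -[X in X - _]mul1r -mulrBl mulf_eq0 subr_eq0 eq_sym.
by rewrite (negbTE pz).
Qed.

(** u / v is b x + a / (x - s) + c / x. Both factors of v are kept even if s = 0, so that the
    degrees are always 3 and 2. *)
Let v : {poly 'F_p} := 'X * ('X - s%:P).
Let u : {poly 'F_p} := b *: ('X ^+ 2 * ('X - s%:P)) + (a *: 'X + c *: ('X - s%:P)).

Let size_v : size v = 3.
Proof. by rewrite size_mul ?polyX_eq0 ?polyXsubC_eq0 // size_polyX size_XsubC. Qed.

Let size_u : size u = 4.
Proof.
have s1 : size (b *: ('X ^+ 2 * ('X - s%:P))) = 4.
  rewrite size_scale // size_mul ?expf_neq0 ?polyX_eq0 ?polyXsubC_eq0 //.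
  by rewrite size_polyXn size_XsubC.
rewrite size_polyDl s1 //; apply: leq_ltn_trans (size_polyD _ _) _.
rewrite gtn_max !(leq_ltn_trans (size_scale_leq _ _)) ?size_polyX ?size_XsubC //.
Qed.

Section Base.

Variables (K : closedFieldType) (io : {rmorphism 'F_p -> K}).

Let ev_u x : (map_poly io u).[x] =
  io b * (x ^+ 2 * (x - io s)) + (io a * x + io c * (x - io s)).
Proof.
have mX : map_poly io ('X - s%:P) = 'X - (io s)%:P.
  by rewrite rmorphB /= map_polyX map_polyC.
by rewrite /u !rmorphD /= !linearZ /= rmorphM rmorphXn /= !map_polyX !mX !hornerE.
Qed.

Let ev_v x : (map_poly io v).[x] = x * (x - io s).
Proof. by rewrite /v rmorphM rmorphB /= map_polyX map_polyC !hornerE. Qed.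

Let f x := io b * x + io a / (x - io s) + io c / x.

Let ev_uv x : (map_poly io v).[x] != 0 ->
  (map_poly io u).[x] / (map_poly io v).[x] = f x.
Proof.
rewrite ev_u ev_v mulf_eq0 negb_or => /andP[x0 xs].
by rewrite /f; field; rewrite x0 xs.
Qed.

Let G n x : C := psi (inFp io (trFp p n (f x))).

Let expsumE n : expsum io psi u v n =
  \sum_(x <- Fpn p K n | ~~ ((x == 0) || (x == io s))) G n x.
Proof.
apply: eq_big => x; first by rewrite ev_v mulf_eq0 subr_eq0.
by move=> /ev_uv ->.
Qed.

Let expsum2E n : (0 < n)%N -> expsum io psi (u \Po 'X^2) (v \Po 'X^2) n =
  \sum_(x <- Fpn p K n | ~~ ((x == 0) || (x == io s)))
     (1 + legendre C (inFp io (nmFp p n x))) * G n x.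
Proof.
move=> n0; rewrite /expsum.
have comp (r : {poly 'F_p}) z : (map_poly io (r \Po 'X^2)).[z] = (map_poly io r).[z ^+ 2].
  by rewrite map_comp_poly map_polyXn horner_comp hornerXn.
under eq_bigl => z do rewrite comp.
under eq_bigr => z do rewrite !comp.
rewrite [RHS]big_seq_cond.
have -> : \sum_(x <- Fpn p K n | (x \in Fpn p K n) && ~~ ((x == 0) || (x == io s)))
     (1 + legendre C (inFp io (nmFp p n x))) * G n x =
  \sum_(x <- Fpn p K n | (map_poly io v).[x] != 0)
    \sum_(z <- Fpn p K n | z ^+ 2 == x) G n x.
  rewrite [RHS]big_seq_cond; apply: eq_big => x.
    by rewrite ev_v mulf_eq0 subr_eq0.
  move=> /andP[xn]; rewrite negb_or => /andP[x0 _].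
  rewrite (legendre_nmFp io) // -sum1_count natr_sum mulr_suml.
  by apply: eq_bigr => z _; rewrite mul1r.
rewrite (exchange_big_dep predT) //= big_seq_cond [RHS]big_seq.
rewrite big_mkcondr; apply: eq_bigr => z zn.
have z2n : z ^+ 2 \in Fpn p K n.
  by move: zn; rewrite !mem_Fpn // exprAC => /eqP ->.
rewrite (big_rem _ z2n) /= eqxx andbT big1_seq; last first.
  move=> x; rewrite (mem_rem_uniq _ (uniq_Fpn io p_pr n0)) !inE.
  by case/andP => /andP[_ /eqP <-]; rewrite eqxx.
by rewrite addr0; case: ifP => // /ev_uv ->.
Qed.

Definition weil_term (eta : 'F_p -> C) x : C :=
  if (x == 0) || (x == s) then 0 else eta x * psi (b * x + a / (x - s) + c / x).

Let conjsumE eta n : (0 < n)%N -> conjsum io psi eta b a c s n =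
  \sum_(x <- Fpn p K n | ~~ ((x == 0) || (x == io s))) eta (inFp io (nmFp p n x)) * G n x.
Proof.
move=> n0; rewrite [RHS]big_mkcond /conjsum; apply: eq_big_seq => x.
rewrite mem_Fpn // => /eqP xn; rewrite Lambda_conjpoly //.
by case: ifP.
Qed.

Let conjsum1 eta : conjsum io psi eta b a c s 1 = \sum_x weil_term eta x.
Proof.
rewrite conjsumE // big_mkcond.
have -> : \sum_x weil_term eta x =
    \sum_(x <- [seq io x | x <- enum 'F_p]) weil_term eta (inFp io x).
  by rewrite big_map big_enum; apply: eq_bigr => x _; rewrite inFp_io.
rewrite (perm_big [seq io x | x <- enum 'F_p]) /=; last first.
  apply: uniq_perm; first exact: (uniq_Fpn io).
    by rewrite map_inj_uniq ?enum_uniq //; apply: fmorph_inj.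
  move=> y; rewrite mem_Fpn // expn1; apply/eqP/mapP => [yp|[x _ ->]].
    by exists (inFp io y); rewrite ?mem_enum ?inFpK.
  by have := io_Frob io p_pr 1 x; rewrite expn1.
rewrite !big_map; apply: eq_bigr => x _; rewrite inFp_io // /weil_term fmorph_eq0.
rewrite (inj_eq (fmorph_inj io)); case: (_ || _) => //=.
rewrite /G /nmFp /trFp !big_ord1 expn0 !expr1 inFp_io //.
suff -> : f (io x) = io (b * x + a / (x - s) + c / x) by rewrite inFp_io.
by rewrite /f 2!rmorphD !fmorph_div rmorphM rmorphB.
Qed.

Let psi_sum := add_char_sum.

(** For eta = 1 the fraction u / v has a simple pole at infinity. For the Legendre symbol, eta = (1
    + eta) - 1, and 1 + eta leads to u(x^2) / v(x^2), whose pole at infinity has order 2, prime to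
    the odd p. *)
Lemma conjsum_even_le eta : eta = (fun=> 1) \/ eta = @legendre C p ->
  exists B k0 : nat, forall k, (k0 <= k)%N ->
    `|conjsum io psi eta b a c s (2 * k)| <= B%:R * p%:R ^+ k.
Proof.
have v0 : v != 0 by rewrite -size_poly_eq0 size_v.
have [B1 [k1 H1]] := @expsum_even_le p K io p_pr C psi psi_norm psi_sum u v 1 v0
  (etrans size_u (congr1 S (esym size_v))) isT (coprime1n _).
case=> [->|->].
  exists B1, k1.+1 => k lek; have k0 : (0 < 2 * k)%N by lia.
  rewrite conjsumE //; under eq_bigr => x _ do rewrite mul1r.
  by rewrite -expsumE -natrX -natrM H1 // ltnW.
have sc (r : {poly 'F_p}) : r != 0 -> size (r \Po 'X^2) = (2 * (size r).-1).+1.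
  move=> r0; have := size_comp_poly r 'X^2; rewrite size_polyXn /= mulnC => <-.
  by rewrite prednK // size_poly_gt0 comp_poly_eq0 ?size_polyXn.
have v20 : v \Po 'X^2 != 0 by rewrite -size_poly_eq0 sc // size_v.
have u0 : u != 0 by rewrite -size_poly_eq0 size_u.
have su2 : size (u \Po 'X^2) = (2 + size (v \Po 'X^2))%N by rewrite !sc // size_u size_v.
have cop2 : coprime 2 p by rewrite prime_coprime // dvdn2 p_odd.
have [B2 [k2 H2]] := @expsum_even_le p K io p_pr C psi psi_norm psi_sum _ _ 2 v20 su2 isT cop2.
exists (B2 + B1)%N, (maxn k1 k2).+1 => k lek; have k0 : (0 < 2 * k)%N by lia.
have -> : conjsum io psi (@legendre C p) b a c s (2 * k) =
    expsum io psi (u \Po 'X^2) (v \Po 'X^2) (2 * k) - expsum io psi u v (2 * k).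
  rewrite conjsumE // expsum2E // expsumE -sumrB; apply: eq_bigr => x _.
  by rewrite mulrDl mul1r addrAC subrr add0r.
apply: le_trans (ler_normB _ _) _; rewrite natrD mulrDl -natrX -!natrM.
by apply: lerD; [apply: H2|apply: H1]; lia.
Qed.

Lemma weil_bound_base eta :
  eta = (fun=> 1) \/ eta = @legendre C p -> `|\sum_x weil_term eta x| <= 4 * sqrtC p%:R.
Proof.
move=> etaP; have [etaM eta1] : (forall x y, eta (x * y) = eta x * eta y) /\ eta 1 = 1.
  by case: etaP => ->; split=> *; rewrite ?mulr1 ?legendreM ?legendre1.
have [ws sws wsE] := conjsum_powersums io p_pr psiD add_char0 etaM eta1 a c s b0 psi_nt.
have [B [k0 HB]] := conjsum_even_le etaP.
have p0 : 0 < p%:R :> C by rewrite ltr0n prime_gt0.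
have wsb w : w \in ws -> `|w| <= sqrtC p%:R.
  move=> wws; rewrite -(ler_pXn2r (n := 2)) ?nnegrE ?sqrtC_ge0 ?ler0n // sqrtCK.
  (* [wsE] concerns positive exponents; starting at k0 + 1 ensures k >= 1. *)
  apply: (powersum_bound archi (B := B) (k0 := k0.+1) p0) wws => k lek.
  have := HB k (ltnW lek); have -> : (2 * k = (2 * k).-1.+1)%N by lia.
  by rewrite wsE normrN.
rewrite -conjsum1 wsE normrN; apply: le_trans (ler_norm_sum _ _ _) _.
apply: (@le_trans _ _ (\sum_(w <- ws) sqrtC p%:R)); last first.
  by rewrite big_const_seq count_predT sws iter_addr addr0 mulr_natl.
by rewrite big_seq [leRHS]big_seq; apply: ler_sum => w ww; rewrite expr1 wsb.
Qed.

End Base.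

Theorem weil_bound eta : eta = (fun=> 1) \/ eta = @legendre C p ->
  `|\sum_x weil_term eta x| <= 4 * sqrtC p%:R.
Proof.
have [K [/= io _]] := countable_algebraic_closure 'F_p.
exact: weil_bound_base io eta.
Qed.

End WeilBound.

(** * Correlations of sums over modular square roots *)

Section Phases.

Variables (F : fieldType) (f lam b : F).
Hypothesis f0 : f != 0.

(** Partial fractions for the arguments t = 1 / y and k t, with f = 4 in the application; the null
    term 0 / (y - 0) gives the shape of [weil_term]. *)
Lemma phase_proportional k y : k != 0 -> y != 0 ->
  lam ^+ 2 / (f * y^-1) - lam ^+ 2 / (f * (k * y^-1)) + (y^-1 - k * y^-1) * b =
  lam ^+ 2 / f * (1 - k^-1) * y + 0 / (y - 0) + b * (1 - k) / y.
Proof. by move=> k0 y0; field; rewrite y0 k0 f0. Qed.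

(** The same for t = 1 / (y - s) and k t + h, where k = s h; the coefficient lam^2 / f of y does not
    involve k. *)
Lemma phase_mobius s h y : h != 0 -> y != 0 -> y - s != 0 ->
  lam ^+ 2 / (f * (y - s)^-1) - lam ^+ 2 / (f * (h * y / (y - s))) +
    ((y - s)^-1 - h * y / (y - s)) * b =
  - (lam ^+ 2 / f * (s + h^-1)) - b * h +
    (lam ^+ 2 / f * y + b * (1 - s * h) / (y - s) + lam ^+ 2 / f * s / h / y).
Proof. by move=> h0 y0 ys; field; rewrite ys y0 h0 f0. Qed.

End Phases.

Section SquareRootSums.

Variables (p : nat) (C : numClosedFieldType) (psi : 'F_p -> C).
Hypotheses (p_pr : prime p) (archi : Num.archimedean_axiom C).
Hypotheses (psiD : forall a b, psi (a + b) = psi a * psi b).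
Hypotheses (psi_norm : forall a, `|psi a| = 1).
Variable lam : 'F_p.

Definition sqrtsum (k : 'F_p) : C := \sum_(x : 'F_p | x ^+ 2 == k) psi (lam * x).

Lemma sqrtsum_le2 k : `|sqrtsum k| <= 2.
Proof.
apply: le_trans (ler_norm_sum _ _ _) _.
under eq_bigr => x _ do rewrite psi_norm.
rewrite sumr_const -[2]/(2%:R) ler_nat cardE.
have sz : size ('X^2 - k%:P : {poly 'F_p}) = 3%N.
  rewrite size_polyDl size_polyXn // size_polyN.
  exact: leq_ltn_trans (size_polyC_leq1 _) _.
rewrite -ltnS -sz; apply: max_poly_roots; rewrite ?enum_uniq //.
  by rewrite -size_poly_eq0 sz.
by apply/allP => x; rewrite mem_enum /root !hornerE subr_eq0.
Qed.

(** Within a residue class, i is determined by its quotient by p. *)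
Lemma card_residue L (y : 'F_p) : (#|[set i : 'I_L | (i%:R : 'F_p) == y]| <= (L %/ p).+1)%N.
Proof.
pose h (i : 'I_L) : 'I_(L %/ p).+1 := inord (i %/ p).
have hE i : h i = (i %/ p)%N :> nat.
  by rewrite inordK // ltnS leq_div2r // ltnW.
rewrite -[X in (_ <= X)%N]card_ord -(card_in_imset (f := h)); first exact: max_card.
move=> i j; rewrite !inE => /eqP iy /eqP jy /(congr1 val) /=; rewrite !hE => ij.
apply/val_inj => /=; rewrite (divn_eq i p) (divn_eq j p) ij; congr (_ + _)%N.
have := congr1 val (etrans iy (esym jy)).
by rewrite /= !val_Fp_nat.
Qed.

Hypotheses (p_odd : odd p) (psi_nt : exists z, psi z != 1).

Let psi0 : psi 0 = 1. Proof. exact: add_char0. Qed.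
Let p_gt0 : 0 < p%:R :> C. Proof. by rewrite ltr0n prime_gt0. Qed.
Let psiN x : psi (- x) = (psi x)^*.
Proof.
have nx : psi x != 0 by rewrite -normr_eq0 psi_norm oner_eq0.
apply: (mulfI nx); rewrite -psiD subrr psi0 -normCK psi_norm expr1n //.
Qed.

Lemma add_char_orthogonality y : \sum_x psi (x * y) = if y == 0 then p%:R else 0.
Proof.
have [->|y0] := eqVneq y 0.
  under eq_bigr => x _ do rewrite mulr0 psi0.
  by rewrite sumr_const card_Fp.
by rewrite -(reindex_inj (mulIf y0) (P := predT)) /=; apply: add_char_sum.
Qed.

Let two_neq0 : (2 : 'F_p) != 0.
Proof.
rewrite -(dvdn_pcharf (pchar_Fp p_pr)) dvdn_prime2 //.
by apply: contraL p_odd => /eqP->.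
Qed.

Let four_neq0 : (4 : 'F_p) != 0.
Proof. by rewrite [4](_ : _ = 2 * 2) ?mulf_neq0 // -natrM. Qed.

Let gauss u : C := \sum_x psi (u * x ^+ 2).
Local Notation chi := (@legendre C p).

Lemma sum_sqr (f : 'F_p -> C) : \sum_x f (x ^+ 2) = \sum_y (1 + chi y) * f y.
Proof.
have [K [/= io _]] := countable_algebraic_closure 'F_p.
rewrite (partition_big (fun x : 'F_p => x ^+ 2) predT) //=; apply: eq_bigr => y _.
have -> : \sum_(x : 'F_p | x ^+ 2 == y) f (x ^+ 2) =
    (count (fun x : 'F_p => x ^+ 2 == y) (enum 'F_p))%:R * f y.
  rewrite -sum1_count natr_sum mulr_suml big_enum_cond /=; apply: eq_bigr => x /eqP->.
  by rewrite mul1r.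
congr (_ * _).
have [->|y0] := eqVneq y 0.
  rewrite /legendre eqxx addr0 (eq_count (a2 := pred1 0)); last first.
    by move=> x /=; rewrite expf_eq0.
  by rewrite count_uniq_mem ?enum_uniq // mem_enum.
have ioy : io y \in Fpn p K 1 by rewrite mem_Fpn // io_Frob.
have := legendre_nmFp io C p_pr p_odd (isT : (0 < 1)%N) ioy.
rewrite fmorph_eq0 /nmFp big_ord1 expr1 inFp_io // => /(_ y0) ->; congr (_%:R).
have pe : perm_eq (Fpn p K 1) [seq io x | x <- enum 'F_p].
  apply: uniq_perm; first exact: (uniq_Fpn io).
    by rewrite map_inj_uniq ?enum_uniq //; apply: fmorph_inj.
  move=> z; rewrite mem_Fpn // expn1; apply/eqP/mapP => [zp|[x _ ->]].
    by exists (inFp io z); rewrite ?mem_enum ?inFpK.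
  by have := io_Frob io p_pr 1 x; rewrite expn1.
rewrite (permP pe) [RHS]count_map; apply: eq_count => x /=.
by rewrite -rmorphXn (inj_eq (fmorph_inj io)).
Qed.

Let chi0 : chi 0 = 0. Proof. by rewrite /legendre eqxx. Qed.
Let chiV x : x != 0 -> chi x * chi x = 1.
Proof. by rewrite /legendre => /negbTE ->; case: ifP; rewrite ?mulrNN mulr1. Qed.

Let gaussE u : u != 0 -> gauss u = chi u * gauss 1.
Proof.
move=> u0; have gE v : v != 0 -> gauss v = \sum_y chi y * psi (v * y).
  move=> v0; rewrite /gauss (sum_sqr (fun y => psi (v * y))).
  under eq_bigr => y _ do rewrite mulrDl mul1r (mulrC v).
  rewrite big_split /= add_char_orthogonality (negbTE v0) add0r.
  by apply: eq_bigr => y _; rewrite (mulrC v).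
rewrite !gE ?oner_eq0 // mulr_sumr.
rewrite [RHS](reindex_inj (mulfI u0)) /=; apply: eq_bigr => y _.
by rewrite legendreM // mulrA mulrA chiV // !mul1r.
Qed.

Let gauss_norm : gauss 1 * (gauss 1)^* = p%:R.
Proof.
rewrite /gauss rmorph_sum mulr_suml.
under eq_bigr => x _ do rewrite mulr_sumr.
transitivity (\sum_x \sum_d psi (x * (d *+ 2)) * psi (d ^+ 2)).
  rewrite exchange_big; apply: eq_bigr => y _.
  rewrite (reindex_inj (addrI y)) /=; apply: eq_bigr => d _.
  by rewrite -psiN -!psiD !mul1r; congr psi; ring.
rewrite exchange_big (bigD1 0) //= [X in _ + X]big1 ?addr0; last first.
  move=> d d0; have d2 : d *+ 2 != 0 by rewrite -mulr_natr mulf_neq0.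
  by rewrite -mulr_suml add_char_orthogonality (negbTE d2) mul0r.
by rewrite -mulr_suml add_char_orthogonality mul0rn eqxx expr0n psi0 mulr1.
Qed.

Hypothesis lam0 : lam != 0.

Let kap t : C := chi (- t) * psi (lam ^+ 2 / (4 * t)).

(** Detecting x^2 = k by additive characters leaves the sums over x of psi(lam x - t x^2), and
    completing the square evaluates them; at t = 0 the sum vanishes, lam being nonzero, in agreement
    with kap 0 = 0. *)
Let sqrtsumE k : sqrtsum k = gauss 1 / p%:R * \sum_t kap t * psi (t * k).
Proof.
have hatE t : \sum_x psi (lam * x - t * x ^+ 2) = gauss 1 * kap t.
  have [->|t0] := eqVneq t 0.
    rewrite /kap oppr0 chi0 mul0r mulr0.
    under eq_bigr => x _ do rewrite mul0r subr0 mulrC.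
    by rewrite add_char_orthogonality (negbTE lam0).
  rewrite /kap mulrA (mulrC (gauss 1)) -gaussE ?oppr_eq0 // /gauss mulr_suml.
  rewrite (reindex_inj (addIr (lam / (2 * t)))) /=; apply: eq_bigr => x _.
  rewrite -psiD; congr psi; field.
  by rewrite t0 two_neq0 four_neq0.
rewrite mulrAC mulr_sumr; under eq_bigr => t _ do rewrite mulrA -hatE mulr_suml.
rewrite exchange_big /=.
have -> : sqrtsum k = (\sum_x psi (lam * x) * \sum_t psi (t * (k - x ^+ 2))) / p%:R.
  rewrite mulr_suml /sqrtsum big_mkcond; apply: eq_bigr => x _.
  rewrite add_char_orthogonality subr_eq0 eq_sym; case: eqP => _.
    by rewrite mulfK // gt_eqF.
  by rewrite mulr0 mul0r.
congr (_ / _); apply: eq_bigr => x _; rewrite mulr_sumr; apply: eq_bigr => t _.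
by rewrite -!psiD; congr psi; ring.
Qed.

Variable b : 'F_p.

Let cc t := kap t * psi (t * b).

Let cc0 : cc 0 = 0.
Proof. by rewrite /cc /kap oppr0 chi0 !mul0r. Qed.

Let chi_conj x : (chi x)^* = chi x.
Proof.
by rewrite /legendre; do 2?case: ifP => _; rewrite ?rmorphN ?rmorph1 ?rmorph0.
Qed.

Let chi_norm_le1 x : `|chi x| <= 1.
Proof.
rewrite /legendre; do 2?case: ifP => _; rewrite ?normrN ?normr1 ?normr0 //.
Qed.

Let ccE t t2 : cc t * (cc t2)^* =
  chi (t * t2) * psi (lam ^+ 2 / (4 * t) - lam ^+ 2 / (4 * t2) + (t - t2) * b).
Proof.
have -> : t * t2 = (- t) * (- t2) by rewrite mulrNN.
rewrite /cc /kap !rmorphM /= chi_conj -!psiN legendreM //.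
have -> : psi (lam ^+ 2 / (4 * t) - lam ^+ 2 / (4 * t2) + (t - t2) * b) =
    psi (lam ^+ 2 / (4 * t)) * psi (t * b) * (psi (- (lam ^+ 2 / (4 * t2))) * psi (- (t2 * b))).
  by rewrite -!psiD; congr psi; ring.
ring.
Qed.

Let corr k h := \sum_t cc t * (cc (k * t + h))^*.

(* For h <> 0 the substitution t = 1 / (y - s) with s = k / h makes
   k t + h = h y / (y - s). *)
Lemma correlation_le k h : k != 1 -> `|corr k h| <= 4 * sqrtC p%:R.
Proof.
move=> k1; have sq0 : 0 <= 4 * sqrtC p%:R :> C by rewrite mulr_ge0 ?sqrtC_ge0 ?ltW.
have B0 : lam ^+ 2 / 4 != 0 by rewrite mulf_neq0 ?expf_neq0 ?invr_eq0.
(* For h = 0 and k <> 0 the substitution is t = 1 / y, the character becomes the constant chi(k),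
   and k <> 1 keeps the coefficient of y nonzero. *)
have [h0|h0] := eqVneq h 0.
  have [k0|k0] := eqVneq k 0.
    rewrite /corr big1 ?normr0 // => t _.
    by rewrite h0 k0 mul0r addr0 cc0 rmorph0 mulr0.
  have B1 : lam ^+ 2 / 4 * (1 - k^-1) != 0.
    by rewrite mulf_neq0 // subr_eq0 eq_sym invr_eq1.
  have -> : corr k h = chi k *
      \sum_x weil_term psi 0 (lam ^+ 2 / 4 * (1 - k^-1)) (b * (1 - k)) 0 (fun=> 1) x.
    rewrite /corr (reindex_inj invr_inj) /= mulr_sumr; apply: eq_bigr => y _.
    rewrite /weil_term orbb; have [->|y0] := eqVneq y 0.
      by rewrite invr0 cc0 mul0r mulr0.
    rewrite ccE h0 addr0 mul1r.
    have -> : y^-1 * (k * y^-1) = k * (y^-1 * y^-1) by ring.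
    rewrite legendreM // legendreM // chiV ?invr_eq0 // mulr1; congr (_ * psi _).
    exact: phase_proportional.
  rewrite normrM; apply: le_trans (ler_wpM2r _ (chi_norm_le1 _)) _; first exact: normr_ge0.
  by rewrite mul1r; apply: weil_bound => //; left.
pose s := k / h.
pose cst := - (lam ^+ 2 / 4 * (s + h^-1)) - b * h.
have -> : corr k h = chi h * psi cst *
    \sum_x weil_term psi (b * (1 - k)) (lam ^+ 2 / 4) (lam ^+ 2 / 4 * s / h) s (@legendre C p) x.
  (* As 0^-1 = 0, this is a permutation of F_p. It sends y = s to t = 0, and y = 0 to a zero of k t
     + h, or to t = 0 if s = 0; [cc] vanishes in each case. *)
  have inj : injective (fun y => (y - s)^-1) by move=> x y /invr_inj /addIr.
  rewrite /corr (reindex_inj inj) /= mulr_sumr; apply: eq_bigr => y _.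
  rewrite /weil_term; have [->|y0] /= := eqVneq y 0.
    rewrite mulr0 sub0r; have [s0|s0] := eqVneq s 0.
      by rewrite s0 oppr0 invr0 cc0 mul0r.
    have -> : k * (- s)^-1 + h = 0.
      have k0 : k != 0 by apply: contraNneq s0 => k0; rewrite /s k0 mul0r.
      by rewrite /s; field; rewrite h0 oppr_eq0.
    by rewrite cc0 rmorph0 mulr0.
  have [->|ys] := eqVneq y s; first by rewrite subrr invr0 cc0 mul0r mulr0.
  have ys0 : y - s != 0 by rewrite subr_eq0.
  have t2E : k * (y - s)^-1 + h = h * y / (y - s).
    have -> : k = s * h by rewrite /s mulfVK.
    by field.
  rewrite ccE t2E.
  have -> : (y - s)^-1 * (h * y / (y - s)) = h * y * ((y - s)^-1 * (y - s)^-1) by ring.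
  rewrite legendreM // [chi (_ * _^-1)]legendreM // chiV ?invr_eq0 // mulr1 legendreM //.
  rewrite mulrACA -psiD; congr (_ * psi _).
  rewrite /cst (_ : k = s * h); last by rewrite /s mulfVK.
  exact: phase_mobius.
rewrite !normrM psi_norm mulr1.
apply: le_trans (ler_wpM2r _ (chi_norm_le1 _)) _; first exact: normr_ge0.
by rewrite mul1r; apply: weil_bound => //; right.
Qed.

Variables (a : 'F_p) (L : nat).
Hypothesis a0 : a != 0.

Let dirichlet h : C := \sum_(i < L) psi (i%:R * h).

Let dirichlet2 h : \sum_(i < L) \sum_(j < L) psi ((i%:R - j%:R) * h) = `|dirichlet h| ^+ 2.
Proof.
rewrite normCK /dirichlet rmorph_sum mulr_suml; apply: eq_bigr => i _.
rewrite mulr_sumr; apply: eq_bigr => j _.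
by rewrite mulrBl psiD psiN.
Qed.

(** By orthogonality the sum is p times the number of pairs with i = j mod p. *)
Lemma dirichlet_l2 : \sum_h `|dirichlet h| ^+ 2 <= (p * (L * (L %/ p).+1))%:R.
Proof.
under eq_bigr => h _ do rewrite -dirichlet2.
rewrite exchange_big /=; under eq_bigr => i _ do rewrite exchange_big /=.
apply: (@le_trans _ _ (\sum_(i < L) (p * (L %/ p).+1)%:R)); last first.
  by rewrite sumr_const card_ord -mulrnA ler_nat mulnAC -mulnA mulnC.
apply: ler_sum => i _.
under eq_bigr => j _.
  under eq_bigr => h _ do rewrite mulrC.
  rewrite add_char_orthogonality subr_eq0 eq_sym.
  over.
rewrite -big_mkcond sumr_const -mulrnA ler_nat leq_mul2l; apply/orP; right.
by have := card_residue L (i%:R); rewrite cardsE.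
Qed.

Definition corrsum n1 n2 : C :=
  \sum_(i < L) \sum_(j < L) sqrtsum (a * (i%:R - j%:R) * n1 + b) *
     (sqrtsum (a * (i%:R - j%:R) * n2 + b))^*.

Lemma corrsum_trivial n1 n2 : `|corrsum n1 n2| <= 4 * (L ^ 2)%:R.
Proof.
apply: (@le_trans _ _ (\sum_(i < L) \sum_(j < L) 4)).
  apply: le_trans (ler_norm_sum _ _ _) _; apply: ler_sum => i _.
  apply: le_trans (ler_norm_sum _ _ _) _; apply: ler_sum => j _.
  rewrite normrM norm_conjC (_ : 4 = 2 * 2); last by rewrite -natrM.
  by apply: ler_pM; rewrite ?normr_ge0 ?sqrtsum_le2.
by rewrite !sumr_const card_ord -mulrnA mulr_natr mulnn.
Qed.

Lemma corrsum_conj n1 n2 : corrsum n2 n1 = (corrsum n1 n2)^*.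
Proof.
rewrite /corrsum !rmorph_sum; apply: eq_bigr => i _; rewrite rmorph_sum; apply: eq_bigr => j _.
by rewrite rmorphM /= conjCK mulrC.
Qed.

(** After both Fourier expansions, i and j contribute |D|^2 at a (n1 t1 - n2 t2), and t2 = (n1 / n2)
    t1 + h separates this from the correlation. The factor p on the left cancels |gauss 1 / p|^2 = 1
    / p. *)
Let corrsumE n1 n2 : n2 != 0 ->
  p%:R * corrsum n1 n2 = \sum_h `|dirichlet (- (a * n2 * h))| ^+ 2 * corr (n1 / n2) h.
Proof.
move=> n20.
have sE k n : sqrtsum (a * k * n + b) = gauss 1 / p%:R * \sum_t cc t * psi (a * k * n * t).
  rewrite sqrtsumE; congr (_ * _); apply: eq_bigr => t _.
  by rewrite /cc -[RHS]mulrA -psiD; congr (_ * psi _); ring.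
have gg : (gauss 1 / p%:R) * (gauss 1 / p%:R)^* = p%:R^-1.
  rewrite rmorphM fmorphV rmorph_nat mulrACA gauss_norm mulrA divff ?mul1r //.
  exact: lt0r_neq0.
have -> : corrsum n1 n2 = p%:R^-1 * \sum_(i < L) \sum_(j < L) \sum_t1 \sum_t2
    cc t1 * (cc t2)^* * psi ((i%:R - j%:R) * (a * (n1 * t1 - n2 * t2))).
  rewrite -gg mulr_sumr; apply: eq_bigr => i _; rewrite mulr_sumr; apply: eq_bigr => j _.
  rewrite !sE rmorphM mulrACA; congr (_ * _).
  rewrite rmorph_sum mulr_suml; apply: eq_bigr => t1 _.
  rewrite mulr_sumr; apply: eq_bigr => t2 _.
  rewrite rmorphM /= -psiN mulrACA -psiD; congr (_ * psi _); ring.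
rewrite mulrA divff ?lt0r_neq0 // mul1r.
under eq_bigr => i _ do rewrite exchange_big /=.
rewrite exchange_big /=.
transitivity (\sum_t1 \sum_t2 cc t1 * (cc t2)^* * `|dirichlet (a * (n1 * t1 - n2 * t2))| ^+ 2).
  apply: eq_bigr => t1 _.
  under eq_bigr => i _ do rewrite exchange_big /=.
  rewrite exchange_big /=; apply: eq_bigr => t2 _.
  by rewrite -dirichlet2 mulr_sumr; apply: eq_bigr => i _; rewrite mulr_sumr.
under [RHS]eq_bigr => h _ do rewrite mulr_sumr.
rewrite [RHS]exchange_big /=; apply: eq_bigr => t1 _.
rewrite (reindex_inj (addrI (n1 / n2 * t1))) /=; apply: eq_bigr => h _.
rewrite mulrC; congr (`|dirichlet _| ^+ 2 * _).
by field.
Qed.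

Lemma corrsum_le n1 n2 : n1 != n2 ->
  `|corrsum n1 n2| <= 4 * sqrtC p%:R * (L * (L %/ p).+1)%:R.
Proof.
(* If n2 = 0 then n1 <> 0, and exchanging the two only conjugates [corrsum]. *)
wlog n20 : n1 n2 / n2 != 0.
  move=> H n12; have [n20|] := eqVneq n2 0; last by move/H; apply.
  rewrite -norm_conjC -corrsum_conj; apply: H; last by rewrite eq_sym.
  by rewrite -n20.
move=> n12; rewrite -(ler_pM2l p_gt0) -[p%:R in leLHS](ger0_norm (ltW p_gt0)) -normrM corrsumE //.
apply: le_trans (ler_norm_sum _ _ _) _.
apply: (@le_trans _ _ (\sum_h `|dirichlet h| ^+ 2 * (4 * sqrtC p%:R))).
  have inj : injective (fun h => - (a * n2 * h)).
    by move=> x y /oppr_inj /mulfI; apply; rewrite mulf_neq0.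
  rewrite [leRHS](reindex_inj inj) /=; apply: ler_sum => h _.
  rewrite normrM ger0_norm ?exprn_ge0 // ler_wpM2l ?exprn_ge0 //.
  apply: correlation_le; apply: contra n12 => /eqP e.
  by rewrite -(mulfVK n20 n1) e mul1r.
rewrite -mulr_suml mulrC mulrCA ler_wpM2l ?mulr_ge0 ?sqrtC_ge0 ?(ltW p_gt0) //.
by rewrite -natrM dirichlet_l2.
Qed.

End SquareRootSums.

(** * The second moment *)

Section SecondMoment.

Variables (p : nat) (C : numClosedFieldType) (psi : 'F_p -> C).
Hypotheses (p_pr : prime p) (archi : Num.archimedean_axiom C).
Hypotheses (psiD : forall a b, psi (a + b) = psi a * psi b).
Hypotheses (psi_norm : forall a, `|psi a| = 1).
Variables (a b lam : 'F_p) (N H : nat) (beta : nat -> C) (Bd : C).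
Hypothesis beta_le : forall n, (n < N)%N -> `|beta n| <= Bd.
Hypothesis Bd0 : 0 <= Bd.

Definition inner_sum (m : 'F_p) : C :=
  \sum_(n < N) beta n * sqrtsum psi lam (a * m * n.+1%:R + b).

Lemma inner_sum_le m : `|inner_sum m| <= 2 * N%:R * Bd.
Proof.
apply: le_trans (ler_norm_sum _ _ _) _.
apply: (@le_trans _ _ (\sum_(n < N) Bd * 2)).
  apply: ler_sum => n _; rewrite normrM ler_pM ?normr_ge0 ?beta_le //.
  exact: sqrtsum_le2.
rewrite sumr_const card_ord -[leLHS]mulr_natr [leLHS](_ : _ = 2 * N%:R * Bd) //; ring.
Qed.

(* Each m in [1, H] is a difference i - j with 0 <= i, j < 2H in at least
   H ways. *)
Lemma fejer_majorant (g : 'F_p -> C) : (forall x, 0 <= g x) ->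
  H%:R * \sum_(m < H) g m.+1%:R <=
  \sum_(i < 2 * H) \sum_(j < 2 * H) g (i%:R - j%:R).
Proof.
move=> g0; rewrite exchange_big /= mulSn mul1n big_split_ord /=.
rewrite -[leLHS]addr0; apply: lerD; last first.
  by apply: sumr_ge0 => i _; apply: sumr_ge0.
rewrite -[H in H%:R]card_ord -sumr_const mulr_suml; apply: ler_sum => j _.
rewrite mul1r.
have lejH : (j.+1 <= H)%N by [].
rewrite -(big_mkord predT (fun i => g (i%:R - j%:R))).
(* Cutting at j + 1 and j + 1 + H isolates the indices i = j + m with 1 <= m <= H, all below 2 H
   since j < H. *)
rewrite (@big_cat_nat _ _ _ j.+1) //=; last by rewrite (leq_trans lejH) ?leq_addr.
rewrite [X in _ <= _ + X](@big_cat_nat _ _ _ (j.+1 + H)) //=; rewrite ?leq_addr ?leq_add2r //.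
rewrite -[leLHS]add0r; apply: lerD; first by apply: sumr_ge0.
rewrite -[leLHS]addr0; apply: lerD; last by apply: sumr_ge0.
rewrite -{1}[j.+1]add0n big_addn addKn big_mkord le_eqVlt; apply/orP; left; apply/eqP.
by apply: eq_bigr => m _; congr g; rewrite -addSnnS natrD addrK.
Qed.

Hypotheses (p_odd : odd p) (psi_nt : exists z, psi z != 1).
Hypotheses (a0 : a != 0) (lam0 : lam != 0).

(** The pairs n1 = n2 mod p, at most N (N / p + 1) of them, take the trivial bound 4 (2 H)^2; the
    correlation bound is then allotted to all N^2 pairs. *)
Lemma second_moment_le :
  H%:R * \sum_(m < H) `|inner_sum m.+1%:R| ^+ 2 <=
  Bd ^+ 2 * ((N * (N %/ p).+1)%:R * (4 * ((2 * H) ^ 2)%:R) +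
    (N * N)%:R * (4 * sqrtC p%:R * (2 * H * (2 * H %/ p).+1)%:R)).
Proof.
set L := (2 * H)%N; set D := 4 * (L ^ 2)%:R; set O := 4 * sqrtC p%:R * _.
have D0 : 0 <= D by rewrite mulr_ge0.
have O0 : 0 <= O by rewrite !mulr_ge0 ?sqrtC_ge0.
apply: le_trans (fejer_majorant (g := fun x => `|inner_sum x| ^+ 2) _) _.
  by move=> x; rewrite exprn_ge0.
pose cs (n1 n2 : 'I_N) := corrsum psi lam b a L n1.+1%:R n2.+1%:R.
rewrite -[leLHS]ger0_norm; last first.
  by apply: sumr_ge0 => i _; apply: sumr_ge0 => j _; rewrite exprn_ge0.
have -> : \sum_(i < L) \sum_(j < L) `|inner_sum (i%:R - j%:R)| ^+ 2 =
    \sum_(n1 < N) \sum_(n2 < N) beta n1 * (beta n2)^* * cs n1 n2.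
  transitivity (\sum_(i < L) \sum_(j < L) \sum_(n1 < N) \sum_(n2 < N) beta n1 * (beta n2)^* *
    (sqrtsum psi lam (a * (i%:R - j%:R) * n1.+1%:R + b) *
     (sqrtsum psi lam (a * (i%:R - j%:R) * n2.+1%:R + b))^*)).
    apply: eq_bigr => i _; apply: eq_bigr => j _.
    rewrite normCK /inner_sum rmorph_sum mulr_suml; apply: eq_bigr => n1 _.
    by rewrite mulr_sumr; apply: eq_bigr => n2 _; rewrite rmorphM mulrACA.
  under eq_bigr => i _ do rewrite exchange_big /=.
  rewrite exchange_big /=; apply: eq_bigr => n1 _.
  under eq_bigr => i _ do rewrite exchange_big /=.
  rewrite exchange_big /=; apply: eq_bigr => n2 _.
  by rewrite mulr_sumr; apply: eq_bigr => i _; rewrite mulr_sumr.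
apply: (@le_trans _ _ (\sum_(n1 < N) \sum_(n2 < N)
    Bd ^+ 2 * ((if n2.+1%:R == n1.+1%:R :> 'F_p then D else 0) + O))).
  apply: le_trans (ler_norm_sum _ _ _) _; apply: ler_sum => n1 _.
  apply: le_trans (ler_norm_sum _ _ _) _; apply: ler_sum => n2 _.
  rewrite !normrM norm_conjC; apply: ler_pM; rewrite ?mulr_ge0 ?normr_ge0 //.
    by rewrite expr2; apply: ler_pM; rewrite ?normr_ge0 ?beta_le.
  case: eqP => [_|/eqP ne].
    by apply: (@le_trans _ _ D); [apply: corrsum_trivial | rewrite lerDl].
  by rewrite add0r corrsum_le // eq_sym.
under eq_bigr => n1 _ do rewrite -mulr_sumr.
rewrite -mulr_sumr ler_wpM2l ?exprn_ge0 //.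
under eq_bigr => n1 _ do rewrite big_split -big_mkcond !sumr_const card_ord.
rewrite big_split /= sumr_const card_ord lerD //; last first.
  by rewrite -mulrnA mulr_natl.
apply: (@le_trans _ _ (\sum_(n1 < N) D *+ (N %/ p).+1)); last first.
  by rewrite sumr_const card_ord -mulrnA mulr_natl mulnC.
apply: ler_sum => n1 _; apply: ler_wpMn2l => //.
(* [card_residue] counts indices from 0, while the variables here are n + 1; hence the shift by
   1. *)
have := card_residue p_pr N (n1.+1%:R - 1); rewrite cardsE; apply: leq_trans.
apply/subset_leq_card/fintype.subsetP => n2 h.
have {}h : n2.+1%:R == n1.+1%:R :> 'F_p := h.
have h1 : n2%:R == n1.+1%:R - 1 :> 'F_p by rewrite -(eqP h) -natr1 addrK.
exact: h1.
Qed.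

End SecondMoment.

(** * The additive character of F_q given by the complex exponential *)

Section ComplexExponential.

Variable R : realType.
Implicit Types (s t : R) (z : R[i]).

Lemma cabsE z : `|z| = (cabs z)%:C%C.
Proof. by rewrite normc_def. Qed.

Lemma cabs_ge0 z : 0 <= cabs z.
Proof. exact: sqrtr_ge0. Qed.

Lemma archi_complex : Num.archimedean_axiom R[i].
Proof.
move=> z; exists (Num.truncn (cabs z)).+1.
rewrite cabsE -(rmorph_nat (real_complex R)) ltcR.
exact: truncnS_gt.
Qed.

Lemma sqrtC_nat q : sqrtC (q%:R : R[i]) = (Num.sqrt (q%:R : R))%:C%C.
Proof.
rewrite -(rmorph_nat (real_complex R)) -{1}(sqr_sqrtr (ler0n R q)) rmorphXn sqrCK //.
by rewrite lecR sqrtr_ge0.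
Qed.

Lemma e_D s t : e_ (s + t) = e_ s * e_ t.
Proof.
rewrite /e_ mulrDr cosD sinD; apply/eqP; rewrite eq_complex /=.
by rewrite eqxx /= addrC mulrC [X in _ + X == _]mulrC (mulrC (cos _)) eqxx.
Qed.

Lemma e_norm t : `|e_ t| = 1.
Proof. by rewrite normc_def /= cos2Dsin2 sqrtr1. Qed.

Lemma e_nat n : e_ (n%:R : R) = 1.
Proof.
elim: n => [|n IHn]; first by rewrite /e_ mulr0 cos0 sin0.
rewrite -natr1 e_D IHn mul1r /e_ mulr1.
by rewrite mulr_natl cos2pi sin2pi.
Qed.

Lemma e_int (z : int) : e_ (z%:~R : R) = 1.
Proof.
case: z => n; first exact: e_nat.
rewrite NegzE mulrNz; have := e_D (- n.+1%:R) n.+1%:R.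
by rewrite addNr e_nat mulr1 (e_nat 0).
Qed.

Variables (q : nat).
Hypothesis q_pr : prime q.

Definition fp_char (x : 'F_q) : R[i] := e_ ((x : nat)%:R / q%:R).

Let q_neq0 : (q%:R : R) != 0.
Proof. by rewrite pnatr_eq0 -lt0n prime_gt0. Qed.

Lemma fp_char_int (z : int) : fp_char (z%:~R) = e_ (z%:~R / q%:R).
Proof.
set y : 'F_q := z%:~R.
have : (z - (y : nat)%:Z)%:~R = 0 :> 'F_q.
  by rewrite intrB -pmulrn natr_Zp subrr.
move/eqP; rewrite -(dvdz_pcharf (pchar_Fp q_pr)) => /dvdzP[k kE].
have -> : z = k * q%:Z + (y : nat)%:Z by rewrite -kE subrK.
rewrite intrD intrM -!pmulrn mulrDl e_D mulfK // e_int mul1r.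
by [].
Qed.

Lemma fp_charD x y : fp_char (x + y) = fp_char x * fp_char y.
Proof.
have -> : x + y = ((x : nat)%:Z + (y : nat)%:Z)%:~R by rewrite intrD -!pmulrn !natr_Zp.
by rewrite fp_char_int intrD -!pmulrn mulrDl e_D.
Qed.

Lemma fp_char_norm x : `|fp_char x| = 1.
Proof. exact: e_norm. Qed.

(** For q >= 3 the angle 2 pi / q lies strictly between 0 and pi, so its sine is positive. *)
Lemma fp_char_nontrivial : odd q -> exists x, fp_char x != 1.
Proof.
move=> q_odd; exists 1; have -> : 1 = 1%:~R :> 'F_q by [].
rewrite fp_char_int /e_ eq_complex negb_and /= orbC gt_eqF //.
have q3 : (2 < q)%N by rewrite odd_prime_gt2.
have q0 : 0 < q%:R :> R by rewrite ltr0n ltnW // ltnW.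
apply: sin_gt0_pi; rewrite ?mulr_gt0 ?pi_gt0 ?invr_gt0 //.
rewrite mul1r ltr_pdivrMr // mulrC ltr_pM2l ?pi_gt0 //.
by rewrite ltr_nat.
Qed.

(** Passes from ['I_q], over which the statement sums, to ['F_q], an ordinal type whose bound is q
    only up to a cast. *)
Lemma sum_ord_Fp (V : nmodType) (P : pred 'F_q) (G : 'F_q -> V) :
  \sum_(x < q | P x%:R) G x%:R = \sum_(y | P y) G y.
Proof.
rewrite (reindex (fun x : 'I_q => x%:R)) //=.
exists (fun y : 'F_q => cast_ord (Fp_cast q_pr) y) => [x _|y _].
  by apply/val_inj => /=; rewrite val_Fp_nat // modn_small.
by rewrite /= natr_Zp.
Qed.

Lemma WsumE (a b lam : int) (alpha beta : nat -> R[i]) (M N : R) :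
  Wsum q a b lam alpha beta M N = \sum_(m < Num.truncn M) alpha m.+1 *
    inner_sum fp_char a%:~R b%:~R lam%:~R (Num.truncn N) (fun n => beta n.+1) m.+1%:R.
Proof.
rewrite /Wsum big_add1 big_mkord; apply: eq_bigr => m _.
rewrite big_add1 big_mkord mulr_sumr; apply: eq_bigr => n _.
rewrite -mulrA; congr (_ * (_ * _)); rewrite /sqrtsum.
rewrite -(sum_ord_Fp (fun y => y ^+ 2 == _) (fun y => fp_char (lam%:~R * y))).
apply: eq_big => x.
  rewrite (dvdz_pcharf (pchar_Fp q_pr)) intrB subr_eq0 intrD expr2 !intrM -expr2.
  by rewrite -!pmulrn.
by move=> _; rewrite (_ : lam%:~R * x%:R = (lam * x%:Z)%:~R) ?fp_char_int // intrM -pmulrn.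
Qed.

End ComplexExponential.

(** * Cauchy's inequality and the final bound *)

Lemma cauchy_schwarz_ord (R : realDomainType) n (x y : 'I_n -> R) :
  (\sum_i x i * y i) ^+ 2 <= (\sum_i x i ^+ 2) * (\sum_i y i ^+ 2).
Proof.
rewrite -(ler_pMn2r (n := 2)) // -subr_ge0.
(* Lagrange's identity. *)
have -> : (\sum_i x i ^+ 2) * (\sum_i y i ^+ 2) *+ 2 - (\sum_i x i * y i) ^+ 2 *+ 2 =
    \sum_i \sum_j (x i * y j - x j * y i) ^+ 2.
  rewrite mulr2n {2}[_ * \sum_i y i ^+ 2]mulrC expr2 !mulr_suml -sumrMnl -big_split -sumrB.
  apply: eq_bigr => i _; rewrite !mulr_sumr -sumrMnl -big_split -sumrB.
  by apply: eq_bigr => j _ /=; ring.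
by apply: sumr_ge0 => i _; apply: sumr_ge0 => j _; apply: sqr_ge0.
Qed.

Section FinalBound.

Variables (R : realType) (q : nat) (a b lam : 'F_q) (N H : nat).
Variables (beta : nat -> R[i]) (Bd : R).
Hypotheses (q_pr : prime q) (a0 : a != 0) (lam0 : lam != 0).
Hypothesis beta_le : forall n, (n < N)%N -> cabs (beta n) <= Bd.
Hypothesis Bd0 : 0 <= Bd.

Let A m := inner_sum (@fp_char R q) a b lam N beta m.

Let beta_leC n : (n < N)%N -> `|beta n| <= (Bd%:C)%C.
Proof. by move=> nN; rewrite cabsE lecR beta_le. Qed.

Let Bd0C : 0 <= (Bd%:C)%C :> R[i]. Proof. by rewrite lecR. Qed.

Lemma second_moment_real : odd q ->
  H%:R * \sum_(m < H) cabs (A m.+1%:R) ^+ 2 <=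
  Bd ^+ 2 * ((N * (N %/ q).+1)%:R * (4 * ((2 * H) ^ 2)%:R) +
    (N * N)%:R * (4 * Num.sqrt q%:R * (2 * H * (2 * H %/ q).+1)%:R)).
Proof.
move=> q_odd.
have := second_moment_le q_pr (@archi_complex R) (@fp_charD R q q_pr)
  (@fp_char_norm R q) b H beta_leC Bd0C
  q_odd (fp_char_nontrivial R q_pr q_odd) a0 lam0.
rewrite sqrtC_nat.
under eq_bigr => m _ do rewrite cabsE -rmorphXn.
rewrite -!(rmorph_nat (real_complex R)) -rmorph_sum /=.
rewrite -!rmorphXn -!rmorphM -!rmorphD -!rmorphM lecR.
by [].
Qed.

(** The trivial bound 2 N Bd for each inner sum; it serves q = 2. *)
Lemma second_moment_small : \sum_(m < H) cabs (A m.+1%:R) ^+ 2 <= H%:R * (2 * N%:R * Bd) ^+ 2.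
Proof.
rewrite -[H in H%:R]card_ord -sumr_const mulr_suml; apply: ler_sum => m _.
rewrite mul1r ler_pXn2r ?nnegrE ?cabs_ge0 ?mulr_ge0 //.
rewrite -lecR -cabsE !rmorphM /= !rmorph_nat.
apply: inner_sum_le => //; exact: fp_char_norm.
Qed.

Variables (M' N' r : R).
Hypotheses (H0 : (0 < H)%N) (HM : H%:R <= M') (NN : N%:R <= N').
Hypotheses (r0 : 0 < r) (r4 : r ^+ 4 = q%:R).

Lemma second_moment_final :
  \sum_(m < H) cabs (A m.+1%:R) ^+ 2 <=
  (6 * Bd * (Num.sqrt M' * Num.sqrt N' + Num.sqrt M' * N' * r^-1 + N' * r)) ^+ 2.
Proof.
set X := \sum_(m < H) _.
have q2 : 2 <= q%:R :> R by rewrite ler_nat prime_gt1.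
have q0 : 0 < q%:R :> R by apply: lt_le_trans q2.
have h0 : 0 < H%:R :> R by rewrite ltr0n.
have M0 : 0 <= M' by apply: le_trans HM.
have N0 : 0 <= N' by apply: le_trans NN.
have n0 : 0 <= N%:R :> R by [].
have r0' := ltW r0.
have sM : Num.sqrt M' ^+ 2 = M' by rewrite sqr_sqrtr.
have sN : Num.sqrt N' ^+ 2 = N' by rewrite sqr_sqrtr.
have r1 : 1 < r.
  rewrite ltNge; apply/negP => rle1; have := exprn_ile1 4 (ltW r0) rle1.
  by rewrite r4; lra.
have rr : r^-1 * r = 1 by rewrite mulVf ?gt_eqF.
have ri0 : 0 < r^-1 by rewrite invr_gt0.
have ri1 : r^-1 <= 1 by rewrite invf_le1 // ltW.
set P := Num.sqrt M' * Num.sqrt N'; set Q := Num.sqrt M' * N' * r^-1; set T := N' * r.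
have P0 : 0 <= P by rewrite mulr_ge0 ?sqrtr_ge0.
have Q0 : 0 <= Q by rewrite !mulr_ge0 ?sqrtr_ge0 // ltW.
have T0 : 0 <= T by rewrite mulr_ge0 // ltW.
have P2 : P ^+ 2 = M' * N' by rewrite exprMn sM sN.
have Q2 : Q ^+ 2 = M' * N' ^+ 2 * r^-1 ^+ 2 by rewrite !exprMn sM.
have T2 : T ^+ 2 = N' ^+ 2 * r ^+ 2 by rewrite exprMn.
(* For odd q the constants at P^2, Q^2 and T^2 come out as 16, 32 and 8, and q = 2 gives 8 at Q^2;
   36 = 6^2 covers them all, and the cross terms are nonnegative. *)
suff XB : X <= Bd ^+ 2 * (36 * P ^+ 2 + 36 * Q ^+ 2 + 36 * T ^+ 2).
  apply: le_trans XB _.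
  have -> : (6 * Bd * (P + Q + T)) ^+ 2 = Bd ^+ 2 * (36 * (P + Q + T) ^+ 2) by ring.
  rewrite ler_wpM2l ?sqr_ge0 //.
  have := mulr_ge0 P0 Q0; have := mulr_ge0 P0 T0; have := mulr_ge0 Q0 T0; nra.
(* When q = 2, r^2 <= 2 makes the trivial bound comparable with Q^2. *)
have [q_odd|q_even] := boolP (odd q); last first.
  have qE : q = 2%N by apply/eqP; rewrite eq_sym -dvdn_prime2 // dvdn2.
  apply: le_trans second_moment_small _.
  have -> : H%:R * (2 * N%:R * Bd) ^+ 2 = Bd ^+ 2 * (4 * (H%:R * N%:R ^+ 2)) by ring.
  rewrite ler_wpM2l ?sqr_ge0 //.
  have HN : H%:R * N%:R ^+ 2 <= M' * N' ^+ 2.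
    by apply: ler_pM; rewrite ?sqr_ge0 // ler_pXn2r ?nnegrE.
  have r2 : r ^+ 2 <= 2.
    rewrite -(ler_pXn2r (n := 2)) ?nnegrE ?sqr_ge0 // -exprM r4 qE.
    by rewrite -natrX ler_nat.
  have ri2 : 1 <= 2 * r^-1 ^+ 2.
    have : r ^+ 2 * r^-1 ^+ 2 <= 2 * r^-1 ^+ 2 by rewrite ler_wpM2r ?sqr_ge0.
    by rewrite -exprMn (mulrC r) rr expr1n.
  have : M' * N' ^+ 2 <= M' * N' ^+ 2 * (2 * r^-1 ^+ 2).
    by rewrite ler_peMr // mulr_ge0 ?sqr_ge0.
  rewrite (_ : _ * (2 * _) = 2 * Q ^+ 2); last by rewrite Q2; ring.
  have := sqr_ge0 P; have := sqr_ge0 Q; have := sqr_ge0 T; lra.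
have sq : Num.sqrt q%:R = r ^+ 2.
  by rewrite -r4 (exprM r 2 2) sqrtr_sqr ger0_norm ?sqr_ge0.
have divle K : ((K %/ q).+1)%:R <= K%:R / q%:R + 1 :> R.
  by rewrite -natr1 lerD2r ler_pdivlMr // -natrM ler_nat leq_trunc_div.
have qi : q%:R^-1 = r^-1 ^+ 4 by rewrite -r4 exprVn.
rewrite -(ler_pM2l h0); apply: le_trans (second_moment_real q_odd) _.
rewrite [leRHS]mulrCA ler_wpM2l ?sqr_ge0 // sq.
apply: (@le_trans _ _ (N%:R * (N%:R / q%:R + 1) * (16 * H%:R ^+ 2) +
  N%:R ^+ 2 * (4 * r ^+ 2 * (2 * H%:R * (2 * H%:R / q%:R + 1))))).
  apply: lerD.
    rewrite natrM (_ : 4 * ((2 * H) ^ 2)%:R = 16 * H%:R ^+ 2); last by rewrite natrX natrM; ring.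
    by rewrite ler_wpM2r ?mulr_ge0 ?sqr_ge0 // ler_wpM2l.
  rewrite natrM -expr2 ler_wpM2l ?sqr_ge0 // ler_wpM2l ?mulr_ge0 ?sqr_ge0 //.
  rewrite !natrM ler_wpM2l ?mulr_ge0 //.
  by apply: le_trans (divle _) _; rewrite natrM.
have -> : N%:R * (N%:R / q%:R + 1) * (16 * H%:R ^+ 2) +
    N%:R ^+ 2 * (4 * r ^+ 2 * (2 * H%:R * (2 * H%:R / q%:R + 1))) =
  H%:R * (16 * (H%:R * N%:R) + 16 * (H%:R * N%:R ^+ 2 * q%:R^-1) +
    16 * (H%:R * N%:R ^+ 2 * (r ^+ 2 * q%:R^-1)) + 8 * (N%:R ^+ 2 * r ^+ 2)) by ring.
rewrite ler_wpM2l ?(ltW h0) //.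
have rq : r ^+ 2 * q%:R^-1 = r^-1 ^+ 2.
  have -> : r ^+ 2 * q%:R^-1 = (r^-1 * r) ^+ 2 * r^-1 ^+ 2 by rewrite qi; ring.
  by rewrite rr expr1n mul1r.
have qle : q%:R^-1 <= r^-1 ^+ 2.
  rewrite qi (exprM _ 2 2) expr2 ler_piMr ?sqr_ge0 //.
  by rewrite exprn_ile1 // ltW.
have HN1 : H%:R * N%:R <= P ^+ 2 by rewrite P2 ler_pM.
have HN2 : H%:R * N%:R ^+ 2 <= M' * N' ^+ 2.
  by apply: ler_pM; rewrite ?sqr_ge0 // ler_pXn2r ?nnegrE.
have HN3 : H%:R * N%:R ^+ 2 * r^-1 ^+ 2 <= Q ^+ 2.
  by rewrite Q2 ler_wpM2r ?sqr_ge0.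
have HN4 : H%:R * N%:R ^+ 2 * q%:R^-1 <= H%:R * N%:R ^+ 2 * r^-1 ^+ 2.
  by rewrite ler_wpM2l // mulr_ge0 ?sqr_ge0.
have HN5 : N%:R ^+ 2 * r ^+ 2 <= T ^+ 2.
  by rewrite T2 ler_wpM2r ?sqr_ge0 // ler_pXn2r ?nnegrE.
rewrite rq; have := sqr_ge0 P; have := sqr_ge0 Q; have := sqr_ge0 T; lra.
Qed.

End FinalBound.

Lemma cabsM (R : realType) (z w : R[i]) : cabs (z * w) = cabs z * cabs w.
Proof. by have := normrM z w; rewrite !cabsE -rmorphM => /(congr1 (@complex.Re R)). Qed.

Lemma cabs_sum_le (R : realType) (I : Type) (s : seq I) (F : I -> R[i]) :
  cabs (\sum_(i <- s) F i) <= \sum_(i <- s) cabs (F i).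
Proof.
rewrite -lecR -cabsE rmorph_sum; apply: le_trans (ler_norm_sum _ _ _) _.
by apply: ler_sum => i _; rewrite cabsE.
Qed.

Lemma norminf_ge0 (R : realType) (beta : nat -> R[i]) (N : R) : 0 <= norminf beta N.
Proof.
rewrite /norminf; elim/big_ind: _ => // [x y x0 y0|n _]; last exact: cabs_ge0.
by rewrite le_max x0.
Qed.

Lemma le_norminf (R : realType) (beta : nat -> R[i]) (N : R) n :
  (n < Num.truncn N)%N -> cabs (beta n.+1) <= norminf beta N.
Proof.
move=> ltn; rewrite /norminf big_add1 big_mkord.
by rewrite (bigD1 (Ordinal ltn)) //= le_max lexx.
Qed.

(** exp(-1/4) >= 3/4 gives exp(1/4) <= 4/3 <= q. The crude value 1/4 has a rational square root. *)
Lemma ln_prime_ge (R : realType) q : prime q -> 1 / 4 <= ln (q%:R : R).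
Proof.
move=> q_pr; have q0 : 0 < q%:R :> R by rewrite ltr0n prime_gt0.
have q2 : 2 <= q%:R :> R by rewrite ler_nat prime_gt1.
rewrite -ler_expR lnK ?posrE //; apply: le_trans q2.
have := @expR_ge1Dx R (- (1 / 4)); rewrite expRN => le1.
have e0 : 0 < expR (1 / 4 : R) by exact: expR_gt0.
have := ler_wpM2r (ltW e0) le1; rewrite mulVf ?gt_eqF //; lra.
Qed.

Theorem theorem2p4 (R : realType) :
  exists c : R, 0 < c /\
  forall (q : nat) (a b lam : int) (M N : R) (alpha beta : nat -> R[i]),
    prime q -> coprimez (a * lam) q -> 1 <= M -> 1 <= N ->
    cabs (Wsum q a b lam alpha beta M N) <=
      c * norm2 alpha M * norminf beta N *
      (Num.sqrt M * Num.sqrt N + Num.sqrt M * N * (q%:R `^ (- (1/4)))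
       + N * (q%:R `^ (1/4)) * Num.sqrt (ln (q%:R))).
Proof.
(* 12 = 6 * 2: the 6 is that of [second_moment_final], and the 2 makes up for (log q)^(1/2) >=
   1/2. *)
exists 12; split; first by rewrite ltr0n.
move=> q a b lam M N alpha beta q_pr cop M1 N1.
have M0 : 0 <= M by apply: le_trans M1.
have N0 : 0 <= N by apply: le_trans N1.
have nz (z : int) : coprimez z q -> z%:~R != 0 :> 'F_q.
  by rewrite -(dvdz_pcharf (pchar_Fp q_pr)) dvdzE coprimezE coprime_sym prime_coprime.
move: cop; rewrite coprimezMl => /andP[/nz a0 /nz lam0].
have q0 : 0 < q%:R :> R by rewrite ltr0n prime_gt0.
set r := q%:R `^ (1 / 4); have r0 : 0 < r by apply: powR_gt0.
have r4 : r ^+ 4 = q%:R.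
  rewrite -(powR_mulrn _ (ltW r0)) /r -powRrM mul1r mulVf ?powRr1 ?ltW //.
rewrite powRN -/r WsumE //.
set H := Num.truncn M; set A := inner_sum _ _ _ _ _ _.
set B := norminf beta N; have B0 : 0 <= B by apply: norminf_ge0.
set P := Num.sqrt M * _; set Q := _ * r^-1; set T := N * r.
have P0 : 0 <= P by rewrite mulr_ge0 ?sqrtr_ge0.
have Q0 : 0 <= Q by rewrite !mulr_ge0 ?sqrtr_ge0 ?invr_ge0 // ltW.
have T0 : 0 <= T by rewrite mulr_ge0 // ltW.
have a2 : 0 <= norm2 alpha M by apply: sqrtr_ge0.
have second : \sum_(m < H) cabs (A m.+1%:R) ^+ 2 <= (6 * B * (P + Q + T)) ^+ 2.
  apply: second_moment_final => //.
  - by move=> n; apply: le_norminf.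
  - by rewrite truncn_gt0.
  - by rewrite -truncn_ge_nat.
  - by rewrite -truncn_ge_nat.
have Wle : cabs (\sum_(m < H) alpha m.+1 * A m.+1%:R) <= norm2 alpha M * (6 * B * (P + Q + T)).
  rewrite -(ler_pXn2r (n := 2)) ?nnegrE ?cabs_ge0 ?mulr_ge0 ?addr_ge0 //.
  have n2 : norm2 alpha M ^+ 2 = \sum_(m < H) cabs (alpha m.+1) ^+ 2.
    rewrite [LHS]sqr_sqrtr; last by apply: sumr_ge0 => m _; apply: sqr_ge0.
    by rewrite big_add1 big_mkord.
  rewrite [leRHS]exprMn n2.
  apply: le_trans (ler_wpM2l _ second); last by apply: sumr_ge0 => m _; apply: sqr_ge0.
  apply: le_trans (cauchy_schwarz_ord _ _).
  rewrite ler_pXn2r ?nnegrE ?cabs_ge0 ?sumr_ge0 //; last first.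
    by move=> m _; rewrite mulr_ge0 ?cabs_ge0.
  apply: le_trans (cabs_sum_le _ _) _.
  by apply: ler_sum => m _; rewrite cabsM.
apply: le_trans Wle _.
have sln : 1 / 2 <= Num.sqrt (ln (q%:R : R)).
  have ln4 := ln_prime_ge R q_pr.
  rewrite -(ler_pXn2r (n := 2)) ?nnegrE ?sqrtr_ge0 // sqr_sqrtr; first by lra.
  by apply: le_trans ln4.
have -> : norm2 alpha M * (6 * B * (P + Q + T)) = norm2 alpha M * B * (6 * (P + Q + T)) by ring.
have -> : 12 * norm2 alpha M * B * (P + Q + T * Num.sqrt (ln q%:R)) =
  norm2 alpha M * B * (12 * (P + Q + T * Num.sqrt (ln q%:R))) by ring.
rewrite ler_wpM2l ?mulr_ge0 //.
have := ler_wpM2l T0 sln; lra.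
Qed.
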